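(* Let $k>0$ and $n\in\mathbb{Z}$. For all $x,y\in[-\pi,\pi]$, $$\mathcal{E}_n^k(ix)\,\mathcal{E}_n^k(iy)=\int_{-\pi}^{\pi}\mathcal{E}_n^k(iz)\,d\mu_k^{(x,y)}(z),$$ where $d\mu_k^{(x,y)}(z)=\mathcal{W}_k(x,y,z)\,dm_k(z)$ if $\sin x\sin y\ne 0$; $\mu_k^{(x,y)}=\delta_x$ if $y=0$; $\mu_k^{(x,y)}=\delta_y$ if $x=0$; $\mu_k^{(x,y)}$ is the Dirac mass at the point of $[-\pi,\pi]$ congruent to $x+\pi$ modulo $2\pi$ if $y=\pm\pi$; and $\mu_k^{(x,y)}$ is the Dirac mass at the point of $[-\pi,\pi]$ congruent to $y+\pi$ modulo $2\pi$ if $x=\pm\pi$.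
   Context: Fix $k>0$. The Cherednik operator of type $A_1$ is $T^k f(x)=f'(x)+2k\,\frac{f(x)-f(-x)}{1-e^{-2x}}-k f(x)$. On $\mathbb{Z}$ define the partial order $j\triangleleft n$ iff either ($|j|<|n|$ and $|n|-|j|$ is a positive even integer) or ($|j|=|n|$ and $n<j$). Let $dm_k(x)=|\sin x|^{2k}dx$ on $[-\pi,\pi]$ and $(f,g)_k=\int_{-\pi}^{\pi}f\bar g\,dm_k$. For $n\in\mathbb{Z}$, $E_n^k$ is the unique function $E_n^k(z)=e^{nz}+\sum_{j\triangleleft n}c_{n,j}e^{jz}$ ($z\in\mathbb{C}$) with $(E_n^k(i\cdot),e^{ij\cdot})_k=0$ for all $j\triangleleft n$; the $c_{n,j}$ are real and nonnegative, $T^kE_n^k=n_kE_n^k$ ($n_k=n+k$ for $n>0$, $n_k=n-k$ for $n\le0$), and $E_n^k(0)>0$. Set $\mathcal{E}_n^k(ix)=E_n^k(ix)/E_n^k(0)$. For $x,y,z\in[-\pi,\pi]$ with $\sin x\sin y\sin z\ne 0$ define $$W_k(x,y,z)=\frac{\Gamma(k+\tfrac12)}{2\Gamma(k)\sqrt{\pi}}\cdot\frac{\bigl\{(\cos z-\cos(x+y))(\cos(x-y)-\cos z)\bigr\}^{k-1}}{|\sin x\sin y\sin z|^{2k-1}}$$ if $\cos(|x|+|y|)<\cos z<\cos(|x|-|y|)$, and $W_k(x,y,z)=0$ otherwise; and $$\mathcal{W}_k(x,y,z)=4\exp\!\Big(\tfrac{i}{2}(x+y-z)\Big)\frac{\sin\frac{x+y+z}{2}\,\sin\frac{-x+y+z}{2}\,\sin\frac{x-y+z}{2}}{\sin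 x\sin y\sin z}\,W_k(x,y,z).$$ $\delta_a$ denotes the Dirac measure at $a$. *)

(* Defs.v *)
From HB Require Import structures.
From mathcomp Require Import all_boot all_order all_algebra.
From mathcomp Require Import all_classical all_reals all_analysis.
From mathcomp Require Import complex.
From Stdlib Require Import ClassicalEpsilon.

Set Implicit Arguments.
Unset Strict Implicit.
Unset Printing Implicit Defensive.

Import Order.TTheory GRing.Theory Num.Theory.
Import numFieldNormedType.Exports.
Local Open Scope classical_set_scope.
Local Open Scope ring_scope.
Local Open Scope complex_scope.

Section Defs.
Variable R : realType.

Local Notation leb := (@lebesgue_measure R).

Definition Gamma (a : R) : R :=
  \int[leb]_(t in `]0%R, +oo[) (t `^ (a - 1) * expR (- t)).

Definition cexpi (t : R) : R[i] := Complex (cos t) (sin t).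

Definition cint (D : set R) (f : R -> R[i]) : R[i] :=
  Complex (\int[leb]_(z in D) complex.Re (f z)) (\int[leb]_(z in D) complex.Im (f z)).

Definition cintegrable (D : set R) (f : R -> R[i]) : Prop :=
  leb.-integrable D (fun z => (complex.Re (f z))%:E) /\
  leb.-integrable D (fun z => (complex.Im (f z))%:E).

Definition tri (j n : int) : bool :=
  ((`|j| < `|n|)%N && ~~ odd (`|n| - `|j|)%N) || ((`|j| == `|n|)%N && (n < j)).

(* the function x |-> e^{inx} + sum_{j <| n} c_j e^{ijx}, i.e. z |-> E(z) at z = ix
   (every j <| n satisfies |j| <= |n|, so summing over -|n| <= j <= |n| suffices) *)
Definition Eform (n : int) (c : int -> R[i]) (x : R) : R[i] :=
  cexpi (n%:~R * x) +
  \sum_(i < (2 * `|n|).+1)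
     (let j := (i%:Z - (`|n|)%:Z)%R in
      if tri j n then c j * cexpi (j%:~R * x) else 0).

(* density of dm_k with respect to Lebesgue measure *)
Definition wk (k z : R) : R := `|sin z| `^ (2 * k).

Definition Ortho (k : R) (n : int) (c : int -> R[i]) : Prop :=
  forall j : int, tri j n ->
    cint `[(- pi)%R, pi] (fun z => Eform n c z * cexpi (- (j%:~R * z)) * (wk k z)%:C) = 0.

(* the coefficients c_{n,j} of E_n^k: the (unique) choice satisfying orthogonality *)
Definition Ecoef (k : R) (n : int) : int -> R[i] :=
  epsilon (inhabits (fun _ => 0)) (Ortho k n).

Definition Ek (k : R) (n : int) (x : R) : R[i] := Eform n (Ecoef k n) x.

Definition calE (k : R) (n : int) (x : R) : R[i] := Ek k n x / Ek k n 0.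

Definition Wk (k x y z : R) : R :=
  if (sin x * sin y * sin z != 0) &&
     (cos (`|x| + `|y|) < cos z < cos (`|x| - `|y|))
  then Gamma (k + 2^-1) / (2 * Gamma k * Num.sqrt pi) *
       ((cos z - cos (x + y)) * (cos (x - y) - cos z)) `^ (k - 1) /
       `|sin x * sin y * sin z| `^ (2 * k - 1)
  else 0.

Definition calW (k x y z : R) : R[i] :=
  (4%:R)%:C * cexpi ((x + y - z) / 2) *
  (sin ((x + y + z) / 2) * sin ((- x + y + z) / 2) * sin ((x - y + z) / 2)
    / (sin x * sin y * sin z) * Wk k x y z)%:C.

(* the point of [-pi, pi] congruent to x + pi modulo 2 pi (for x in [-pi, pi]) *)
Definition shiftpi (x : R) : R := if x <= 0 then x + pi else x - pi.

End Defs.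

(* Main.v *)
Require Import Defs.
From HB Require Import structures.
From mathcomp Require Import all_boot all_order all_algebra.
From mathcomp Require Import all_classical all_reals all_analysis.
From mathcomp Require Import complex.
From mathcomp Require Import measurable_realfun real_interval.
From mathcomp Require Import ring lra zify.
From Stdlib Require ClassicalEpsilon.

Set Implicit Arguments.
Unset Strict Implicit.
Unset Printing Implicit Defensive.
Import Order.TTheory GRing.Theory Num.Theory.
Import numFieldNormedType.Exports.
Local Open Scope classical_set_scope.
Local Open Scope ring_scope.
Local Open Scope complex_scope.

(** With A_m the Gegenbauer polynomials normalised by A_m(1) = 1, one has
    calE_n(x) = A_m(cos x) + (i / nu) sin x A_m'(cos x), where m = |n| and
    nu = m for n > 0, nu = - (m + 2k) for n <= 0.  The substitution
    cos z = cos x cos y + c sin x sin y turns the kernel measure into the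
    probability law proportional to (1 - c^2)^(k-1) dc on ]-1, 1[ (the constant
    is the Beta integral), whose mean M obeys M((1 - c^2) f') = 2k M(c f).
    This rule and the ladder A_(m+1) = u A_m - (1 - u^2) A_m' / (m + 2k) give,
    by induction on m, closed forms for the means of A_m, c A_m, A_m', c A_m';
    the product formula is a combination of these.  The same ladder gives the
    exponential expansion of calE_n and its orthogonality relations, which
    characterise E_n. *)

(** * Gegenbauer polynomials *)

(** For 0 < k < 1 the density (1 - c^2)^(k-1) is unbounded at both ends of ]-1, 1[, so the
    fundamental theorem and substitution are needed on open intervals, for integrands that are
    merely integrable; k > 0 enters through primitives that stay continuous at the ends. A second
    singularity is the factor 1 / sin z of the kernel: when cos(x - y) or cos(x + y) is 1 or -1 the
    support reaches up to a zero of sin z, and integrability rests on a numerator of size O(|sin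
    z|). That factor is odd in z and the remaining weight is even, so only the odd part of the
    numerator contributes, and it is sin z times a polynomial in c: this is how a complex kernel
    leads to means of polynomials. Both values of nu solve nu (nu + 2k) = m (m + 2k), and the
    computation uses only this equation and nu <> 0, so it never separates the signs of n. Finally
    [Ecoef] is chosen by [epsilon]: nothing is known of E_n until some coefficient family is shown
    to be orthogonal, and then only through uniqueness. *)

Section Gegenbauer.
Variables (R : realFieldType) (k : R).
Hypothesis k_gt0 : 0 < k.

(** The ladder is taken as the definition because it is the real part of calE_(m+1)(x) = e^(ix)
    calE_(-m)(-x), the relation behind the exponential expansion ([nsE_posS]). *)
Fixpoint gegen (m : nat) : {poly R} :=
  if m is m'.+1 then
    'X * gegen m' - (m'%:R + 2 * k)^-1 *: ((1 - 'X^2) * (gegen m')^`())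
  else 1.

Lemma gegen_denom_neq0 m : m%:R + 2 * k != 0.
Proof. by rewrite gt_eqF// ltr_wpDl// ?ler0n// mulr_gt0. Qed.

(** The two identities need a joint induction: differentiating the ladder produces a second
    derivative, which the differential equation in degree m removes, and the derivative formula so
    obtained yields the equation in degree m + 1. *)
Lemma gegen_ode_deriv m :
  (1 - 'X^2) * (gegen m)^`()^`() =
    (2 * k + 1) *: ('X * (gegen m)^`()) - (m%:R * (m%:R + 2 * k)) *: gegen m /\
  (gegen m.+1)^`() = m.+1%:R *: (gegen m) +
    (m.+1%:R / (m%:R + 2 * k)) *: ('X * (gegen m)^`()).
Proof.
have derivE (p : {poly R}) :
    ((1 - 'X^2) * p)^`() = (1 - 'X^2) * p^`() - 2 * ('X * p).
  by rewrite derivM derivB derivXn derivC/= expr1; ring.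
have step n : (1 - 'X^2) * (gegen n)^`()^`() =
    (2 * k + 1) *: ('X * (gegen n)^`()) - (n%:R * (n%:R + 2 * k)) *: gegen n ->
  (gegen n.+1)^`() = n.+1%:R *: (gegen n) +
    (n.+1%:R / (n%:R + 2 * k)) *: ('X * (gegen n)^`()).
  move=> ode; rewrite [gegen n.+1]/= derivB derivM derivX mul1r derivZ derivE.
  rewrite ode.
  have := gegen_denom_neq0 n; move: (gegen n) => A; move: A^`() => B.
  rewrite -!mul_polyC -(natr1 n).
  (* Trading k for N = n + 2k makes the denominator a single letter. Polynomials do not form a
     field, so its inverse becomes a constant polynomial [Q] with P Q = 1, and the difference of the
     two sides is displayed as a multiple of P Q - 1. *)
  have [N ->] : exists N, 2 * k = N - n%:R by exists (n%:R + 2 * k); ring.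
  rewrite (addrC n%:R (N - _)) subrK => N0.
  rewrite !(polyCD, polyCM, polyCN, polyCB) polyC1.
  have : N%:P * N^-1%:P = 1 :> {poly R} by rewrite -polyCM divff.
  move: N%:P N^-1%:P n%:R%:P => P Q S /eqP; rewrite -subr_eq0 => /eqP PQ.
  apply/eqP; rewrite -subr_eq0; apply/eqP.
  rewrite [LHS](_ : _ = (P * Q - 1) * (S * A - 'X * B)); first by rewrite PQ mul0r.
  ring.
elim: m => [|m [ode dS]]; last first.
  suff ode1 : (1 - 'X^2) * (gegen m.+1)^`()^`() =
    (2 * k + 1) *: ('X * (gegen m.+1)^`()) -
    (m.+1%:R * (m.+1%:R + 2 * k)) *: gegen m.+1 by split => //; exact: step.
  rewrite dS derivD !derivZ derivM derivX mul1r mulrDr -!scalerAr mulrDr.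
  rewrite (mulrCA _ 'X) ode [gegen m.+1]/=.
  have := gegen_denom_neq0 m; move: (gegen m) => A; move: A^`() => B.
  rewrite -!mul_polyC -(natr1 m).
  have [N ->] : exists N, 2 * k = N - m%:R by exists (m%:R + 2 * k); ring.
  rewrite (addrC m%:R (N - _)) subrK => N0.
  rewrite !(polyCD, polyCM, polyCN, polyCB) polyC1.
  have : N%:P * N^-1%:P = 1 :> {poly R} by rewrite -polyCM divff.
  move: N%:P N^-1%:P m%:R%:P => P Q S /eqP; rewrite -subr_eq0 => /eqP PQ.
  apply/eqP; rewrite -subr_eq0; apply/eqP.
  rewrite [LHS](_ : _ = (P * Q - 1) *
    (- (S + 1) * (1 - 'X^2) * B - (S + 1) * S * 'X * A)).
    by rewrite PQ mul0r.
  ring.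
suff ode0 : (1 - 'X^2) * (gegen 0)^`()^`() =
    (2 * k + 1) *: ('X * (gegen 0)^`()) -
    (0%:R * (0%:R + 2 * k)) *: gegen 0 by split => //; exact: step.
by rewrite /= derivC deriv0 !mulr0 mul0r scale0r scaler0 subr0.
Qed.

Lemma deriv_gegenS m :
  (gegen m.+1)^`() = m.+1%:R *: (gegen m) +
    (m.+1%:R / (m%:R + 2 * k)) *: ('X * (gegen m)^`()).
Proof. exact: (gegen_ode_deriv m).2. Qed.

Lemma gegenS_eval m x : (gegen m.+1).[x] =
  x * (gegen m).[x] - (1 - x ^+ 2) * (gegen m)^`().[x] / (m%:R + 2 * k).
Proof. by rewrite /= !hornerE /=; ring. Qed.

Lemma deriv_gegenS_eval m x : (gegen m.+1)^`().[x] =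
  m.+1%:R * ((gegen m).[x] + x * (gegen m)^`().[x] / (m%:R + 2 * k)).
Proof. by rewrite deriv_gegenS !hornerE /=; ring. Qed.

Lemma gegen1 m : (gegen m).[1] = 1.
Proof.
by elim: m => [|m IH]; rewrite ?gegenS_eval ?IH ?hornerE// expr1n subrr mul0r mul0r subr0.
Qed.

(** * Means of Gegenbauer polynomials along u = XY + bc *)

Section Product.
Variable M : {poly R} -> R.
Hypothesis M_linear : forall a p q, M (a *: p + q) = a * M p + M q.
Hypothesis M1 : M 1 = 1.
Hypothesis M_ibp : forall p, M ((1 - 'X^2) * p^`()) = 2 * k * M ('X * p).

Let M0 : M 0 = 0.
Proof. by have := M_linear (-1) 0 0; rewrite scaler0 addr0; lra. Qed.
Let MZ a p : M (a *: p) = a * M p.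
Proof. by rewrite -[a *: p]addr0 M_linear M0 addr0. Qed.
Let MD p q : M (p + q) = M p + M q.
Proof. by rewrite -[p in LHS]scale1r M_linear mul1r. Qed.

Variables (X Y sx sy : R).
Hypothesis sxE : sx ^+ 2 = 1 - X ^+ 2.
Hypothesis syE : sy ^+ 2 = 1 - Y ^+ 2.

Let b := sx * sy.
Let u : {poly R} := (X * Y)%:P + b *: 'X.

Let M_u p : M (u * p) = X * Y * M p + b * M ('X * p).
Proof. by rewrite /u -(mul_polyC b) mulrDl -mulrA !mul_polyC MD !MZ. Qed.

Let M_uu p : M (u * (u * p)) = (X * Y) ^+ 2 * M p +
  2 * (X * Y) * b * M ('X * p) + b ^+ 2 * M ('X * ('X * p)).
Proof. by rewrite M_u M_u mulrCA M_u; ring. Qed.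

(** This is [M_ibp] applied to [p \Po u]; it eliminates the second moment in c of p'(u). *)
Let M_ibp_u p : b * M ('X * ('X * (p^`() \Po u))) =
  b * M (p^`() \Po u) - 2 * k * M ('X * (p \Po u)).
Proof.
have := M_ibp (p \Po u); rewrite deriv_comp derivD derivC derivZ derivX add0r.
have -> : (1 - 'X^2) * ((p^`() \Po u) * (b *: 1)) = b *: ((1 - 'X^2) * (p^`() \Po u)).
  by rewrite -!mul_polyC; ring.
rewrite MZ.
move=> <-; rewrite mulrBl mul1r MD -mulN1r.
have -> q : -1 * ('X^2 * q) = (-1) *: ('X * ('X * q)) :> {poly R}.
  by rewrite scaleN1r mulN1r expr2 mulrA.
by rewrite MZ; ring.
Qed.

(** For X = cos s and Y = cos t the last two identities are, up to sign, the derivatives of the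
    first in s and in t, and the right side of the second is the mixed derivative of A(X) A(Y). The
    ladder mixes the four means, so they are carried together. Keeping the factor m (m + 2k) on the
    left makes the second identity trivial for m = 0. *)
Lemma gegen_product m :
  [/\ M (gegen m \Po u) = (gegen m).[X] * (gegen m).[Y],
    m%:R * (m%:R + 2 * k) * M ('X * (gegen m \Po u)) =
      b * (gegen m)^`().[X] * (gegen m)^`().[Y],
    sx * Y * M ((gegen m)^`() \Po u) - X * sy * M ('X * ((gegen m)^`() \Po u)) =
      sx * (gegen m)^`().[X] * (gegen m).[Y] &
    X * sy * M ((gegen m)^`() \Po u) - sx * Y * M ('X * ((gegen m)^`() \Po u)) =
      sy * (gegen m).[X] * (gegen m)^`().[Y]].
Proof.
elim: m => [|m [IH1 IH2 IH3 IH4]].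
  by rewrite /= derivC !comp_poly0 comp_polyC mulr0 M0 M1 !hornerE; split => //; ring.
have N0 := gegen_denom_neq0 m.
have S0 : m.+1%:R != 0 :> R by rewrite pnatr_eq0.
have ibp := M_ibp_u (gegen m).
have ibpS := M_ibp_u (gegen m.+1).
move: IH1 IH2 IH3 IH4 ibp ibpS.
have EA : M (gegen m.+1 \Po u) = X * Y * M (gegen m \Po u) +
    b * M ('X * (gegen m \Po u)) - (M ((gegen m)^`() \Po u) -
      ((X * Y) ^+ 2 * M ((gegen m)^`() \Po u) +
      2 * (X * Y) * b * M ('X * ((gegen m)^`() \Po u)) +
      b ^+ 2 * M ('X * ('X * ((gegen m)^`() \Po u))))) / (m%:R + 2 * k).
  rewrite /= comp_polyB comp_polyZ !comp_polyM comp_polyB comp_polyC.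
  rewrite comp_Xn_poly comp_polyX MD M_u -scaleN1r MZ MZ mulrBl mul1r MD expr2.
  by rewrite -[in M (- _)]scaleN1r MZ -[u * u * _]mulrA M_uu; ring.
have Ea : M ((gegen m.+1)^`() \Po u) = m.+1%:R * (M (gegen m \Po u) +
    (X * Y * M ((gegen m)^`() \Po u) + b * M ('X * ((gegen m)^`() \Po u))) /
    (m%:R + 2 * k)).
  rewrite deriv_gegenS comp_polyD !comp_polyZ comp_polyM comp_polyX MD !MZ M_u.
  by ring.
have Eb : M ('X * ((gegen m.+1)^`() \Po u)) = m.+1%:R * (M ('X * (gegen m \Po u)) +
    (X * Y * M ('X * ((gegen m)^`() \Po u)) + b * M ('X * ('X * ((gegen m)^`() \Po u)))) /
    (m%:R + 2 * k)).
  rewrite deriv_gegenS comp_polyD !comp_polyZ comp_polyM comp_polyX mulrDr -!scalerAr.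
  by rewrite MD !MZ mulrCA M_u; ring.
(* Multiplying the ladder by c would bring in a third moment. The inverse relation, which writes
   (m+1) A_(m+1) through A_(m+1)' and A_m', avoids it; with [ibpS] it is a linear system for M(c
   A_(m+1)(u)) and M(c^2 A_(m+1)'(u)). *)
have Ed : m.+1%:R * M ('X * (gegen m.+1 \Po u)) =
    X * Y * M ('X * ((gegen m.+1)^`() \Po u)) +
    b * M ('X * ('X * ((gegen m.+1)^`() \Po u))) -
    m.+1%:R / (m%:R + 2 * k) * M ('X * ((gegen m)^`() \Po u)).
  have E : m.+1%:R *: gegen m.+1 = 'X * (gegen m.+1)^`() -
      (m.+1%:R / (m%:R + 2 * k)) *: (gegen m)^`().
    rewrite deriv_gegenS [gegen m.+1]/= -!mul_polyC !polyCM.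
    by move: (gegen m)^`() (gegen m) => B A; ring.
  rewrite -MZ scalerAr -comp_polyZ E comp_polyB comp_polyM comp_polyX comp_polyZ.
  rewrite mulrBr MD mulrCA M_u -scaleN1r MZ -scalerAr MZ; ring.
rewrite !gegenS_eval !deriv_gegenS_eval -sxE -syE EA Ea Eb.
have eX : X ^+ 2 + sx ^+ 2 - 1 = 0 by rewrite sxE; ring.
have eY : Y ^+ 2 + sy ^+ 2 - 1 = 0 by rewrite syE; ring.
rewrite Eb in Ed; clear EA Ea Eb.
move: N0 Ed; rewrite /b.
have [N ->] : exists N, 2 * k = N - m%:R by exists (m%:R + 2 * k); ring.
rewrite (addrC m%:R (N - _)) subrK.
move: S0; rewrite -(natr1 m) => S0.
move: (M (gegen m \Po u)) (M ('X * (gegen m \Po u))) (M ((gegen m)^`() \Po u)) => a d al.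
move: (M ('X * ((gegen m)^`() \Po u))) (M ('X * ('X * ((gegen m)^`() \Po u)))) => be ga.
move: (M ('X * ('X * ((gegen m.+1)^`() \Po u)))) (M ('X * (gegen m.+1 \Po u))) => ga1 d1.
move: m%:R (gegen m).[X] (gegen m).[Y] (gegen m)^`().[X] (gegen m)^`().[Y] S0.
move=> n P Q P' Q' S0 N0.
move=> /eqP; rewrite -subr_eq0 => /eqP; set hd := (X in X = 0) => hd0.
move=> /eqP; rewrite -subr_eq0 => /eqP; set h1 := (X in X = 0) => h10.
move=> /eqP; rewrite -subr_eq0 => /eqP; set h2 := (X in X = 0) => h20.
move=> /eqP; rewrite -subr_eq0 => /eqP; set h3 := (X in X = 0) => h30.
move=> /eqP; rewrite -subr_eq0 => /eqP; set h4 := (X in X = 0) => h40.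
move=> /eqP; rewrite -subr_eq0 => /eqP; set hg := (X in X = 0) => hg0.
move=> /eqP; rewrite -subr_eq0 => /eqP; set g1 := (X in X = 0) => g10.
set ex := (X in X = 0) in eX; set ey := (X in X = 0) in eY.
(* Each conclusion is certified by an explicit combination of expressions known to vanish: [h1] to
   [h4] are the induction hypotheses, [hg] and [g1] the integrations by parts in degrees m and m +
   1, [hd] is [Ed], and [ex], [ey] are the Pythagorean relations. [field] checks the identity. *)
have key (z e : R) : z = 0 -> e = z -> e = 0 by move=> ->.
split; apply/eqP; rewrite -subr_eq0; apply/eqP.
- apply: (key (N^-1 * (N * X * Y * h1 + sx * sy * hg + sx * sy / N * h2 -
    sx * Y * h3 - X * sy * h4 + al * (ex * (Y ^+ 2 + sy ^+ 2) + ey)))).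
    by rewrite h10 hg0 h20 h30 h40 eX eY; ring.
  by rewrite /h1 /hg /h2 /h3 /h4 /ex /ey; field.
- apply: (key ((n + 1) * (hd + g1) + (n + 1) ^+ 2 / N * (N * sx * sy * h1 +
    X * Y * hg + X * Y / N * h2 + X * sy * h3 + sx * Y * h4 +
    be * (ex * (Y ^+ 2 + sy ^+ 2) + ey)))).
    by rewrite h10 hg0 h20 h30 h40 eX eY hd0 g10; ring.
  by rewrite /h1 /hg /h2 /h3 /h4 /ex /ey /hd /g1; field.
- apply: (key ((n + 1) / N * (N * sx * Y * h1 - X * sy * hg - X * sy / N * h2 +
    X * Y * h3 - sx * sy * h4))).
    by rewrite h10 hg0 h20 h30 h40; ring.
  by rewrite /h1 /hg /h2 /h3 /h4; field.
- apply: (key ((n + 1) / N * (N * X * sy * h1 - sx * Y * hg - sx * Y / N * h2 +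
    X * Y * h4 - sx * sy * h3))).
    by rewrite h10 hg0 h20 h30 h40; ring.
  by rewrite /h1 /hg /h2 /h3 /h4; field.
Qed.
End Product.
End Gegenbauer.

(** * Calculus on open intervals *)

Section OpenIntervalFTC.
Variable R : realType.
Local Notation mu := (@lebesgue_measure R).
Implicit Types (f F G : R -> R) (a b : R).

Lemma measurable_continuous_itvoo f a b :
  {in `]a, b[, continuous f} -> measurable_fun `]a, b[ f.
Proof.
move=> cf; apply: open_continuous_measurable_fun => //.
by move=> x; rewrite inE; exact: cf.
Qed.

(** The integrand may blow up at a and b. Integrating its zero extension over the longer interval
    starting at a - 1 turns a and b into interior points, where the primitive is continuous from
    both sides. *)
Lemma primitive_oo f a b : a < b ->
  {in `]a, b[, continuous f} -> mu.-integrable `]a, b[ (EFin \o f) ->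
  exists G : R -> R, [/\ {in `[a, b], continuous G},
    {in `]a, b[, forall x, is_derive x (1 : R) G (f x)} &
    G b - G a = \int[mu]_(x in `]a, b[) f x].
Proof.
move=> ab cf intf.
pose g := f \_ `]a, b[.
have intg : mu.-integrable `[a - 1, b + 1] (EFin \o g).
  rewrite -restrict_EFin; apply/integrable_restrict => //.
  by rewrite setIidr//; apply: subset_itv; rewrite bnd_simp; lra.
pose G x := \int[mu]_(t in `[a - 1, x]) g t.
have cG : {within `[a - 1, b + 1], continuous G}.
  apply: parameterized_integral_continuous intg; lra.
exists G; split.
- move=> x xab; apply: (within_continuous_continuous _ cG); first lra.
  by rewrite in_itv/=; move: xab; rewrite in_itv/= => /andP[? ?]; apply/andP; lra.
- move=> x xab; have /andP[ax xb] : a < x < b by move: xab; rewrite in_itv.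
  have cg : {for x, continuous g}.
    apply: (cvg_trans _ (cvg_trans (cf x xab) _)).
      apply: near_eq_cvg; near=> t; rewrite /g patchE ifT// inE/=.
      near: t; exact: near_in_itvoo.
    by rewrite /g patchE ifT// inE.
  have [||dGx GxE] := continuous_FTC1_closed _ intg _ cg; [lra|lra|].
  have -> : f x = g x by rewrite /g patchE ifT// inE.
  by rewrite -GxE derive1E; exact/derivableP.
rewrite /G Rintegral_itvB; last 3 first.
- by apply: integrableS intg => //; apply: subset_itvl; rewrite bnd_simp; lra.
- by rewrite bnd_simp; lra.
- by rewrite bnd_simp; lra.
rewrite /g -Rintegral_mkcondr setIidr//.
by apply: subset_itvl; rewrite bnd_simp.
Unshelve. all: by end_near. Qed.

(** [F] and the primitive of [primitive_oo] have the same derivative inside, so by the mean value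
    theorem their difference takes equal values at a and b. *)
Lemma integrable_FTC2_oo f F a b : a < b ->
  {within `[a, b], continuous F} ->
  {in `]a, b[, forall x, is_derive x (1 : R) F (f x)} ->
  {in `]a, b[, continuous f} ->
  mu.-integrable `]a, b[ (EFin \o f) ->
  \int[mu]_(x in `]a, b[) f x = F b - F a.
Proof.
move=> ab cF dF cf intf.
have [G [cG dG <-]] := primitive_oo ab cf intf.
have dH x : x \in `]a, b[ -> is_derive x (1 : R) (F - G) (cst 0 x).
  move=> xab; rewrite /= -(subrr (f x)).
  by apply: is_deriveB; [exact: dF|exact: dG].
have cH : {within `[a, b], continuous (F - G)}.
  move=> x; apply: cvgB; [exact: cF|].
  by apply: continuous_in_subspaceT => t; rewrite inE; exact: cG.
have [c _] := MVT ab dH cH; rewrite mul0r /= !fctE.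
lra.
Qed.

(** The denominators start at 3 so that every closed interval of the exhaustion has distinct
    endpoints, as the closed form of the fundamental theorem requires. *)
Lemma itvoo_bigcup a b : a < b ->
  `]a, b[%classic = \bigcup_n `[a + (b - a) / n.+3%:R, b - (b - a) / n.+3%:R]%classic.
Proof.
move=> ab; apply/seteqP; split => x /=; last first.
  move=> [n _] /=; rewrite !in_itv/= => /andP[h1 h2].
  have p : 0 < (b - a) / n.+3%:R by rewrite divr_gt0// subr_gt0.
  move: p h1 h2; move: (_ / _) => e p h1 h2.
  by apply/andP; split; lra.
rewrite in_itv/= => /andP[ax xb].
pose e := Num.min (x - a) (b - x).
have e0 : 0 < e by rewrite lt_min !subr_gt0 ax.
pose n := Num.truncn ((b - a) / e).
exists n => //=.
have : (b - a) / n.+3%:R <= e.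
  rewrite ler_pdivrMr// mulrC -ler_pdivrMr//.
  have := truncnS_gt ((b - a) / e); rewrite -/n => h.
  by rewrite (le_trans (ltW h))// ler_nat ltnS -addn2 leq_addr.
rewrite /e le_min; move: (_ / _) => r /andP[h1 h2].
by rewrite in_itv/=; apply/andP; split; lra.
Qed.

(** No bound on f is needed: its integrals over the exhausting intervals are increments of the
    nondecreasing function [F], hence at most F b - F a, and monotone convergence concludes. *)
Lemma ge0_integrable_derive_oo f F a b : a < b ->
  {within `[a, b], continuous F} ->
  {in `]a, b[, forall x, is_derive x (1 : R) F (f x)} ->
  {in `]a, b[, continuous f} ->
  {in `]a, b[, forall x, 0 <= f x} ->
  mu.-integrable `]a, b[ (EFin \o f).
Proof.
move=> ab cF dF cf f0.
have mf := measurable_continuous_itvoo cf.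
apply/integrableP; split; first exact/measurable_EFinP.
rewrite [X in (X < _)%E](_ : _ = \int[mu]_(x in `]a, b[) (f x)%:E)%E; last first.
  by apply: eq_integral => x; rewrite inE => xab /=; rewrite ger0_norm// f0.
have sub n x : x \in `[a + (b - a) / n.+3%:R, b - (b - a) / n.+3%:R] -> x \in `]a, b[.
  move=> xn.
  have : (`]a, b[%classic) x by rewrite itvoo_bigcup//; exists n.
  by [].
have incr n : [/\ a < a + (b - a) / n.+3%:R,
    a + (b - a) / n.+3%:R < b - (b - a) / n.+3%:R & b - (b - a) / n.+3%:R < b].
  have e0 : 0 < (b - a) / n.+3%:R by rewrite divr_gt0// subr_gt0.
  have : (b - a) / n.+3%:R * 3 <= b - a.
    rewrite -[leRHS](@divfK _ n.+3%:R)//; rewrite ler_pM2l// ler_nat.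
    by [].
  move: e0; move: (_ / _) => r h1 h2.
  by split; lra.
rewrite itvoo_bigcup//.
apply: (@le_lt_trans _ _ (F b - F a)%:E); last by rewrite ltry.
have cvgI := @ge0_nondecreasing_set_cvg_integral _ (measurableTypeR R) R
  (fun n => `[a + (b - a) / n.+3%:R, b - (b - a) / n.+3%:R]%classic)
  (EFin \o f) mu.
apply: (@cvge_to_le _ _ _ _ _ _ _ (cvgI _ _ _ _)) => //.
- apply/nondecreasing_seqP => n; rewrite subsetEset; apply: subset_itv; rewrite bnd_simp.
    rewrite lerD2l ler_pM2l ?subr_gt0// lef_pV2 ?posrE// ler_nat//.
  by rewrite lerD2l lerN2 ler_pM2l ?subr_gt0// lef_pV2 ?posrE// ler_nat//.
- move=> n; apply/measurable_EFinP; apply: measurable_funS mf => //.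
  by move=> x; exact: sub.
- by move=> n x /sub /f0; rewrite lee_fin.
near=> n.
have [h1 h2 h3] := incr n.
set c := a + _ in h1 h2 *; set d := b - _ in h2 h3 *.
have subn x : x \in `[c, d] -> x \in `]a, b[ by exact: sub.
have dFx x : x \in `]a, b[ -> derivable F x 1 by move=> /dF [].
have Fle p q : a <= p -> p <= q -> q <= b -> F p <= F q.
  move=> ap; rewrite le_eqVlt => /predU1P[->//|pq] qb.
  have [| |z zpq E] := @MVT _ F f p q pq.
  - move=> x xpq; apply: dF; rewrite in_itv/=.
    by rewrite (le_lt_trans ap) ?(lt_le_trans _ qb)// (itvP xpq).
  - by apply: continuous_subspaceW cF; apply: subset_itv; rewrite bnd_simp.
  rewrite -subr_ge0 E mulr_ge0 ?subr_ge0 ?(ltW pq)//; apply: f0.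
  by rewrite in_itv/= (le_lt_trans ap) ?(lt_le_trans _ qb)// (itvP zpq).
rewrite (@continuous_FTC2 _ f F) //.
- by rewrite lee_fin; apply: lerB; apply: Fle; lra.
- apply: continuous_in_subspaceT => x; rewrite inE => xcd.
  exact/cf/subn.
- have : {within `[c, d], continuous F}.
    by apply: continuous_subspaceW cF; apply: subset_itv; rewrite bnd_simp ltW.
  move=> /(continuous_within_itvP _ h2)[_ ? ?]; split => // x xcd.
  apply: dFx; apply: subn; exact: subset_itv_oo_cc xcd.
- move=> x xcd; rewrite derive1E.
  have := dF x (subn _ (subset_itv_oo_cc xcd)) => -[_ <-//].
Unshelve. all: by end_near. Qed.

(** The boolean [sg] records the orientation and is true when [F] reverses it. With P a primitive of
    G, the function (-1)^sg P(F(x)) is a continuous primitive of a nonnegative integrand, so the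
    preceding criterion applies. *)
Lemma ge0_integrable_substitution_oo (sg : bool) G F f (a b c d : R) :
  a < b -> c < d ->
  {in `]c, d[, continuous G} -> mu.-integrable `]c, d[ (EFin \o G) ->
  {in `]c, d[, forall u, 0 <= G u} ->
  continuous F -> {in `]a, b[, forall x, F x \in `]c, d[} ->
  (F a, F b) = (if sg then (d, c) else (c, d)) ->
  {in `]a, b[, forall x, is_derive x (1 : R) F (f x)} ->
  {in `]a, b[, continuous f} -> {in `]a, b[, forall x, 0 <= (-1) ^+ sg * f x} ->
  mu.-integrable `]a, b[ (EFin \o (fun x => G (F x) * f x)).
Proof.
move=> ab cd cG iG G0 cF Fab FE dF cf f0.
have Fa : F a \in `[c, d] by case: sg FE {f0} => -[-> _]; rewrite in_itv/= lexx (ltW cd).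
have Fb : F b \in `[c, d] by case: sg FE {f0} => -[_ ->]; rewrite in_itv/= lexx (ltW cd).
have [P [cP dP _]] := primitive_oo cd cG iG.
have iPF : mu.-integrable `]a, b[
    (EFin \o (fun x => (-1) ^+ sg * (G (F x) * f x))).
  apply: (@ge0_integrable_derive_oo _ (fun x => (-1) ^+ sg * P (F x))) => //.
  - apply: continuous_in_subspaceT => x /set_mem/= xab.
    apply: cvgM; first exact: cvg_cst.
    apply: (@continuous_comp _ _ _ F P); first exact: cF.
    apply: cP; move: xab; rewrite itv_boundlr/= => /andP[]; rewrite !bnd_simp.
    rewrite le_eqVlt => /orP[/eqP<- _//|ax].
    rewrite le_eqVlt => /orP[/eqP->//|xb].
    by apply: subset_itv_oo_cc; apply: Fab; rewrite in_itv/= ax.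
  - move=> x xab; have -> : (-1) ^+ sg * (G (F x) * f x) = (-1) ^+ sg *: (G (F x) * f x) by [].
    apply: (@is_deriveZ _ _ _ (P \o F)).
    have := dP _ (Fab _ xab) => dPx; have := dF _ xab => dFx.
    exact: is_derive1_comp.
  - move=> x xab; apply: cvgM; first exact: cvg_cst.
    apply: cvgM; last exact: cf.
    apply: (@continuous_comp _ _ _ F G); first exact: cF.
    exact/cG/Fab.
  - by move=> x xab; rewrite mulrCA mulr_ge0 ?f0 ?G0 ?Fab.
have := integrableZl _ ((-1) ^+ sg) iPF => /(_ (measurable_itv _)).
apply: eq_integrable => // x _ /=.
by rewrite -EFinM mulrA -signr_addb addbb mul1r.
Qed.

Lemma integral_substitution_oo (sg : bool) G F f (a b c d : R) :
  a < b -> c < d ->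
  {in `]c, d[, continuous G} -> mu.-integrable `]c, d[ (EFin \o G) ->
  continuous F -> {in `]a, b[, forall x, F x \in `]c, d[} ->
  (F a, F b) = (if sg then (d, c) else (c, d)) ->
  {in `]a, b[, forall x, is_derive x (1 : R) F (f x)} ->
  {in `]a, b[, continuous f} ->
  mu.-integrable `]a, b[ (EFin \o (fun x => G (F x) * f x)) ->
  \int[mu]_(x in `]a, b[) (G (F x) * f x) =
  (-1) ^+ sg * \int[mu]_(u in `]c, d[) G u.
Proof.
move=> ab cd cG iG cF Fab FE dF cf iGF.
have Fa : F a \in `[c, d] by case: sg FE => -[-> _]; rewrite in_itv/= lexx (ltW cd).
have Fb : F b \in `[c, d] by case: sg FE => -[_ ->]; rewrite in_itv/= lexx (ltW cd).
have [P [cP dP <-]] := primitive_oo cd cG iG.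
rewrite (@integrable_FTC2_oo _ (P \o F)) //.
- by move: FE; case: (sg) => -[/= -> ->]; rewrite ?expr1 ?expr0; ring.
- apply: continuous_in_subspaceT => x /set_mem/= xab.
  apply: (@continuous_comp _ _ _ F P); first exact: cF.
  apply: cP; move: xab; rewrite itv_boundlr/= => /andP[]; rewrite !bnd_simp.
  rewrite le_eqVlt => /orP[/eqP<- _//|ax].
  rewrite le_eqVlt => /orP[/eqP->//|xb].
  by apply: subset_itv_oo_cc; apply: Fab; rewrite in_itv/= ax.
- move=> x xab.
  have := dP _ (Fab _ xab) => dPx; have := dF _ xab => dFx.
  exact: is_derive1_comp.
- move=> x xab; apply: cvgM; last exact: cf.
  apply: (@continuous_comp _ _ _ F G); first exact: cF.
  exact/cG/Fab.
Qed.

End OpenIntervalFTC.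

(** * The weight on ]-1, 1[ *)

Section Weight.
Variable R : realType.
Local Notation mu := (@lebesgue_measure R).

(** The norm keeps away from the default values of [powR] at negative bases, so continuity holds on
    the whole line, including at 0. *)
Lemma continuous_norm_powR (r : R) : 0 < r -> continuous (fun x : R => `|x| `^ r).
Proof.
move=> r0 x; have [->|x0] := eqVneq x 0.
  rewrite /continuous_at normr0 powR0 ?gt_eqF//.
  apply/cvgr0Pnorm_lt => e e0; near=> t.
  rewrite ger0_norm ?powR_ge0// -[ltRHS](powRr1 (ltW e0)) -(@mulVf _ r) ?gt_eqF//.
  rewrite powRrM gt0_ltr_powR// ?nnegrE ?powR_ge0//.
  near: t; exists (e `^ r^-1) => /=; first by rewrite powR_gt0.
  by move=> t /=; rewrite sub0r normrN.
apply: (@continuous_comp _ _ _ (fun x : R => `|x|) (fun x => x `^ r)).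
  exact: norm_continuous.
apply: differentiable_continuous; apply/derivable1_diffP.
by apply: derivable_powR; rewrite in_itv/= andbT normr_gt0.
Unshelve. all: by end_near. Qed.

Lemma eq_within_continuous (A : set R) (f g : R -> R) :
  {in A, f =1 g} -> continuous f -> {within A, continuous g}.
Proof.
move=> fg cf; have cA : {within A, continuous f} by exact: continuous_subspaceT.
exact: (@subspace_eq_continuous _ A _ f g fg cA).
Qed.

Lemma continuous_powR_gt0 (r x : R) : 0 < x -> {for x, continuous (fun x => x `^ r)}.
Proof.
move=> x0; apply: differentiable_continuous; apply/derivable1_diffP.
by apply: derivable_powR; rewrite in_itv/= andbT.
Qed.

Lemma integrable_bounded_mul (D : set (measurableTypeR R)) (f g : R -> R) (K : R) :
  measurable D -> measurable_fun D g -> (forall x, D x -> `|g x| <= K) ->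
  mu.-integrable D (EFin \o f) ->
  mu.-integrable D (EFin \o (fun x => g x * f x)).
Proof.
move=> mD mg gK intf.
have mf : measurable_fun D f by apply/measurable_EFinP; exact: measurable_int intf.
have H := integrableZl mD K (integrable_abse intf).
refine (le_integrable mD _ _ H).
  exact/measurable_EFinP/measurable_funM.
move=> x Dx /=; rewrite !lee_fin normrM.
have K0 : 0 <= K by exact: le_trans (gK _ Dx).
by rewrite [leRHS]ger0_norm ?mulr_ge0// ler_wpM2r// gK.
Qed.

Lemma integrable_scale (D : set (measurableTypeR R)) (f : R -> R) (r : R) :
  measurable D -> mu.-integrable D (EFin \o f) ->
  mu.-integrable D (EFin \o (fun x => r * f x)).
Proof. by move=> mD; apply: (@integrable_bounded_mul _ _ (fun=> r) `|r|). Qed.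

Lemma horner_bounded (p : {poly R}) :
  exists K, forall c : R, `|c| <= 1 -> `|p.[c]| <= K.
Proof.
exists (\sum_(i < size p) `|p`_i|) => c c1; rewrite horner_coef.
apply: le_trans (ler_norm_sum _ _ _) _; apply: ler_sum => i _.
by rewrite normrM normrX ler_piMr// exprn_ile1.
Qed.

(** A zero integral would force f to vanish almost everywhere, making [D] itself a null set. *)
Lemma integral_pos_gt0 (D : set (measurableTypeR R)) (f : R -> R) : measurable D ->
  (0 < mu D)%E -> measurable_fun D f -> (forall x, D x -> 0 < f x) ->
  (0 < \int[mu]_(x in D) (f x)%:E)%E.
Proof.
move=> mD D0 mf f0; rewrite lt_neqAle integral_ge0 ?andbT; last first.
  by move=> x Dx; rewrite lee_fin ltW// f0.
apply/negP => /eqP/esym I0.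
have /ae_eq_integral_abs : measurable_fun D (EFin \o f) by exact/measurable_EFinP.
move=> /(_ mu mD)[+ _]; rewrite (_ : (\int[mu]_(x in D) `|(EFin \o f) x|)%E = 0%E).
  move=> /(_ erefl)[N [mN N0 sub]].
  have : (mu D <= mu N)%E.
    apply: le_measure; rewrite ?inE// => x Dx; apply: sub => /= /(_ Dx)[fx0].
    by have := f0 x Dx; rewrite fx0 ltxx.
  by rewrite N0 leNgt D0.
by rewrite -I0; apply: eq_integral => x /set_mem Dx /=; rewrite gtr0_norm ?f0.
Qed.

Variable k : R.
Hypothesis k_gt0 : 0 < k.

Definition gweight (c : R) : R := (1 - c ^+ 2) `^ (k - 1).

Let itv1 (c : R) : c \in `]-1, 1[ -> [/\ 0 < 1 - c, 0 < 1 + c & 0 < 1 - c ^+ 2].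
Proof.
rewrite in_itv/= => /andP[h1 h2]; split; [lra|lra|].
by rewrite (_ : 1 - c ^+ 2 = (1 - c) * (1 + c)) ?mulr_gt0; [|lra|lra|ring].
Qed.

Lemma continuous_gweight : {in `]-1, 1[, continuous gweight}.
Proof.
move=> c /itv1[_ _ h].
apply: (@continuous_comp _ _ _ (fun c : R => 1 - c ^+ 2) (fun x => x `^ (k - 1))).
  by apply: cvgB; [exact: cvg_cst|exact: exprn_continuous].
exact: continuous_powR_gt0.
Qed.

(** The weight is the product of the powers of 1 - c and 1 + c, one of which is at most 1, so it is
    bounded by their sum. The sum separates the two singularities and has the primitive ((1 + c)^k -
    (1 - c)^k) / k, continuous on the closed interval because k > 0. *)
Lemma integrable_gweight : mu.-integrable `]-1, 1[ (EFin \o gweight).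
Proof.
pose f (c : R) := (1 + c) `^ (k - 1) + (1 - c) `^ (k - 1).
have intf : mu.-integrable `](-1), 1[ (EFin \o f).
  apply: (@ge0_integrable_derive_oo _ _
     (fun c => k^-1 * (1 + c) `^ k - k^-1 * (1 - c) `^ k)).
  - lra.
  - apply: (@eq_within_continuous _
      (fun c => k^-1 * `|1 + c| `^ k - k^-1 * `|1 - c| `^ k)).
      move=> c /set_mem/=; rewrite in_itv/= => /andP[h1 h2].
      by rewrite !ger0_norm//; lra.
    move=> c.
    apply: cvgB; apply: cvgM; try exact: cvg_cst.
      apply: (@continuous_comp _ _ _ (fun c : R => 1 + c) (fun x => `|x| `^ k)).
        by apply: cvgD; [exact: cvg_cst|exact: cvg_id].
      exact: continuous_norm_powR.
    apply: (@continuous_comp _ _ _ (fun c : R => 1 - c) (fun x => `|x| `^ k)).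
      by apply: cvgB; [exact: cvg_cst|exact: cvg_id].
    exact: continuous_norm_powR.
  - move=> c /itv1[h1 h2 _].
    have d1 : is_derive c (1 : R) (fun c : R => (1 + c) `^ k) (k * (1 + c) `^ (k - 1) * 1).
      have := is_derive1_powR k h2 => h.
      have e : is_derive c (1 : R) (fun c : R => 1 + c) 1.
        by have := is_deriveD (is_derive_cst (1 : R) c 1) (is_derive_id c (1 : R)); rewrite add0r.
      exact (is_derive1_comp (g := fun c : R => 1 + c) h e).
    have d2 : is_derive c (1 : R) (fun c : R => (1 - c) `^ k) (k * (1 - c) `^ (k - 1) * -1).
      have := is_derive1_powR k h1 => h.
      have e : is_derive c (1 : R) (fun c : R => 1 - c) (-1).
        by have := is_deriveB (is_derive_cst (1 : R) c 1) (is_derive_id c (1 : R)); rewrite sub0r.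
      exact (is_derive1_comp (g := fun c : R => 1 - c) h e).
    have := is_deriveB (is_deriveZ k^-1 d1) (is_deriveZ k^-1 d2).
    move=> [h hE]; split => //; rewrite [LHS]hE /f /GRing.scale/=.
    by field; rewrite gt_eqF.
  - move=> c /itv1[h1 h2 _]; apply: cvgD.
      apply: (@continuous_comp _ _ _ (fun c : R => 1 + c) (fun x => x `^ (k - 1))).
        by apply: cvgD; [exact: cvg_cst|exact: cvg_id].
      exact: continuous_powR_gt0.
    apply: (@continuous_comp _ _ _ (fun c : R => 1 - c) (fun x => x `^ (k - 1))).
      by apply: cvgB; [exact: cvg_cst|exact: cvg_id].
    exact: continuous_powR_gt0.
  - by move=> c _; rewrite addr_ge0 ?powR_ge0.
apply: (le_integrable _ _ _ intf) => //.
  by apply/measurable_EFinP; exact: (measurable_continuous_itvoo continuous_gweight).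
move=> c /itv1[h1 h2 _] /=; rewrite lee_fin ger0_norm ?powR_ge0//.
rewrite ger0_norm; last by rewrite addr_ge0 ?powR_ge0.
rewrite /gweight (_ : 1 - c ^+ 2 = (1 - c) * (1 + c)); last by ring.
rewrite powRM ?(ltW h1) ?(ltW h2)//.
have ge1 (x : R) : 1 <= x -> k - 1 <= 0 -> x `^ (k - 1) <= 1.
  by move=> x1 kk; have := ler_powR x1 kk; rewrite powRr0.
have le1 (x : R) : 0 < x <= 1 -> 0 <= k - 1 -> x `^ (k - 1) <= 1.
  by move=> x1 kk; have := ger_powR x1 kk; rewrite powRr0.
have P1 := powR_ge0 (1 - c) (k - 1); have P2 := powR_ge0 (1 + c) (k - 1).
have mulle (A B : R) : 0 <= A -> 0 <= B -> A <= 1 \/ B <= 1 -> A * B <= B + A.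
  move=> A0 B0 [A1|B1]; first by rewrite (le_trans (ler_wpM2r B0 A1))// mul1r lerDl.
  by rewrite (le_trans (ler_wpM2l A0 B1))// mulr1 lerDr.
apply: mulle => //.
have [c0|c0] := leP 0 c; have [kk|/ltW kk] := leP 0 (k - 1).
- by left; apply: le1 => //; lra.
- by right; apply: ge1 => //; lra.
- by right; apply: le1 => //; lra.
- by left; apply: ge1 => //; lra.
Qed.

Lemma integrable_poly_gweight (p : {poly R}) :
  mu.-integrable `]-1, 1[ (EFin \o (fun c => p.[c] * gweight c)).
Proof.
have [K pK] := horner_bounded p.
apply: (@integrable_bounded_mul _ _ (horner p) K) => //.
- exact: measurable_poly.
- move=> c /=; rewrite in_itv/= => /andP[h1 h2]; apply: pK.
  by rewrite ler_norml !ltW.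
- exact: integrable_gweight.
Qed.

(** The difference of the two integrands has primitive p(c) (1 - c^2)^k, which vanishes at both ends
    because k > 0. *)
Lemma gweight_ibp (p : {poly R}) :
  \int[mu]_(c in `]-1, 1[) (((1 - 'X^2) * p^`()).[c] * gweight c) =
  2 * k * \int[mu]_(c in `]-1, 1[) (('X * p).[c] * gweight c).
Proof.
pose q : {poly R} := (1 - 'X^2) * p^`() - (2 * k) *: ('X * p).
have qE : \int[mu]_(c in `]-1, 1[) (q.[c] * gweight c) = 0.
  rewrite (@integrable_FTC2_oo _ _ (fun c => p.[c] * (1 - c ^+ 2) `^ k)).
  - by rewrite expr1n sqrrN expr1n subrr powR0 ?gt_eqF// !mulr0 subrr.
  - lra.
  - apply: (@eq_within_continuous _ (fun c => p.[c] * `|1 - c ^+ 2| `^ k)).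
      move=> c /set_mem/=; rewrite in_itv/= => /andP[h1 h2].
      by rewrite ger0_norm// (_ : 1 - c ^+ 2 = (1 - c) * (1 + c)) ?mulr_ge0; [|lra|lra|ring].
    move=> c; apply: cvgM; first exact: continuous_horner.
    apply: (@continuous_comp _ _ _ (fun c : R => 1 - c ^+ 2) (fun x => `|x| `^ k)).
      by apply: cvgB; [exact: cvg_cst|exact: exprn_continuous].
    exact: continuous_norm_powR.
  - move=> c /itv1[_ _ h].
    have d1 : is_derive c (1 : R) (fun c : R => (1 - c ^+ 2) `^ k)
        (k * (1 - c ^+ 2) `^ (k - 1) * (- (2 * c))).
      have := is_derive1_powR k h => hh.
      have e : is_derive c (1 : R) (fun c : R => 1 - c ^+ 2) (- (2 * c)).
        have [e1 e2] := is_derive_poly (1 - 'X^2) c.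
        have E : horner (1 - 'X^2) = (fun c : R => 1 - c ^+ 2).
          by apply/funext => t; rewrite !hornerE.
        rewrite -E; split => //; rewrite e2 derivB derivC derivXn !hornerE/=.
        by rewrite mulr_natl.
      exact (is_derive1_comp (g := fun c : R => 1 - c ^+ 2) hh e).
    have := is_deriveM (is_derive_poly p c) d1.
    move=> [hh hE]; split => //; rewrite [LHS]hE /q /gweight /GRing.scale/= !hornerE/=.
    rewrite -(@mulr_powRB1 _ (1 - c ^+ 2) k) ?(ltW h)//; ring.
  - move=> c cc; apply: cvgM; [exact: continuous_horner|exact: continuous_gweight].
  - exact: integrable_poly_gweight.
apply/eqP; rewrite -subr_eq0 -qE -RintegralZl//; last exact: integrable_poly_gweight.
rewrite -RintegralB//.
- by apply/eqP; apply: eq_Rintegral => c _; rewrite /q !hornerE/=; ring.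
- exact: integrable_poly_gweight.
- have := integrable_poly_gweight ((2 * k) *: ('X * p)).
  by apply: eq_integrable => // c _ /=; rewrite !hornerE/= -!mulrA.
Qed.

End Weight.

(** * Gamma and Beta integrals *)

Section BetaGamma.
Variable R : realType.
Local Notation mu := (@lebesgue_measure R).

Lemma ge0_integral_shift (f : R -> \bar R) (d : R) :
  measurable_fun [set: R] f -> (forall x, (0 <= f x)%E) ->
  (\int[mu]_x f (x + d)%R = \int[mu]_x f x)%E.
Proof.
move=> mf f0.
pose phi : measurableTypeR R -> measurableTypeR R := fun x => x + d.
have mphi : measurable_fun setT phi by exact: measurable_funD.
pose phi' : {mfun measurableTypeR R >-> measurableTypeR R} :=
  HB.pack phi (isMeasurableFun.Build _ _ _ _ _ mphi).
have H A : measurable A -> pushforward mu phi' A = mu A.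
  move=> mA; apply/esym/lebesgue_measure_unique => //= _ [[a b]] _ <-.
  rewrite /pushforward (_ : phi @^-1` _ = `]a - d, b - d]%classic); last first.
    by apply/seteqP; split => x /=; rewrite !in_itv/= ltrBlDr lerBrDr.
  rewrite !lebesgue_measure_itv/= !lte_fin ltrD2r.
  by case: ifPn => // _; rewrite -!EFinD; congr EFin; ring.
transitivity (\int[pushforward mu phi']_x f x)%E; last first.
  by apply: eq_measure_integral => A mA _; exact: H.
by rewrite ge0_integral_pushforward// preimage_setT.
Qed.

(** Extended real values allow Tonelli before finiteness is known; the real-valued [Gamma] would
    turn an infinite integral into 0. *)
Definition eGamma (a : R) : \bar R :=
  (\int[mu]_(t in `]0%R, +oo[) (t `^ (a - 1) * expR (- t))%:E)%E.

Let mGamma (a : R) D : measurable_fun D (fun t : R => t `^ (a - 1) * expR (- t)).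
Proof.
apply: measurable_funM; first by apply: measurable_funTS; exact: measurable_powR.
by apply: measurable_funTS; apply: measurableT_comp => //; exact: measurable_expR.
Qed.

Lemma eGamma_gt0 a : (0 < eGamma a)%E.
Proof.
apply: integral_pos_gt0 => //.
- by rewrite lebesgue_measure_itv/= ltry oppr0 addye// ltry.
- exact: mGamma.
- by move=> t /=; rewrite in_itv/= andbT => t0; rewrite mulr_gt0 ?powR_gt0 ?expR_gt0.
Qed.

Lemma gweight_int_gt0 (k : R) : 0 < k ->
  0 < \int[mu]_(c in `](-1)%R, 1%R[) gweight k c.
Proof.
move=> k0.
have h : (0 < \int[mu]_(c in `](-1)%R, 1%R[) (gweight k c)%:E)%E.
  apply: integral_pos_gt0 => //.
  - rewrite lebesgue_measure_itv/= lte_fin ifT; last by lra.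
    by rewrite -EFinD lte_fin; lra.
  - exact: (measurable_continuous_itvoo (@continuous_gweight _ k)).
  - move=> c /=; rewrite in_itv/= => /andP[h1 h2]; apply: powR_gt0.
    by rewrite (_ : 1 - c ^+ 2 = (1 - c) * (1 + c)) ?mulr_gt0; [|lra|lra|ring].
have fin : (\int[mu]_(c in `](-1)%R, 1%R[) (gweight k c)%:E)%E \is a fin_num.
  by apply: integrable_fin_num => //; exact: integrable_gweight.
by rewrite /Rintegral -lte_fin fineK.
Qed.

(** The truncated power. The explicit test is needed because [powR] is not 0 at negative bases. *)
Let cut (k t : R) : R := if 0 < t then t `^ (k - 1) else 0.

Let cut_ge0 k t : 0 <= cut k t.
Proof. by rewrite /cut; case: ifP => // _; exact: powR_ge0. Qed.

Let mcut k : measurable_fun [set: R] (cut k).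
Proof.
apply: measurable_fun_ifT => //.
exact: measurable_fun_ltr.
Qed.

(** Scaling v = sqrt(r) c: the power contributes r^(k-1) and dv contributes r^(1/2). *)
Let inner_v (k r : R) : 0 < k -> 0 < r ->
  (\int[mu]_v (expR (- r) * cut k (r - v ^+ 2))%:E =
   (r `^ (k + 2^-1 - 1) * expR (- r) * \int[mu]_(c in `](-1)%R, 1%R[) gweight k c)%:E)%E.
Proof.
move=> k0 r0.
have sr0 : 0 < Num.sqrt r by rewrite sqrtr_gt0.
have srE : Num.sqrt r ^+ 2 = r by rewrite sqr_sqrtr// ltW.
set s := Num.sqrt r in sr0 srE *.
have itvs v : (v \in `]- s, s[) = (v ^+ 2 < r).
  by rewrite in_itv/= -ltr_norml -srE -[v ^+ 2]real_normK ?num_real// ltr_pXn2r// ?nnegrE// ltW.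
pose g (v : R) := gweight k (v / s) * s^-1.
have srn0 : s != 0 by rewrite gt_eqF.
have cF : continuous (fun v : R => v / s).
  by move=> v; apply: cvgM; [exact: cvg_id|exact: cvg_cst].
have Fab : {in `]- s, s[, forall v, v / s \in `](-1)%R, 1%R[}.
  move=> v; rewrite !in_itv/= => /andP[h1 h2].
  by rewrite ltr_pdivlMr// mulN1r h1 ltr_pdivrMr// mul1r.
have FE : (- s / s, s / s) = (-1, 1) by rewrite mulNr divff.
have dF : {in `]- s, s[, forall v, is_derive v (1 : R) (fun v : R => v / s) s^-1}.
  move=> v _; have := is_deriveZ s^-1 (is_derive_id v (1 : R)).
  rewrite /GRing.scale/= mulr1.
  by rewrite (_ : s^-1 \*: id = (fun v => v / s))//; apply/funext => t; rewrite /= mulrC.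
have cf : {in `]- s, s[, continuous (fun _ : R => s^-1)} by move=> v _; exact: cvg_cst.
have ss : - s < s by lra.
have N11 : -1 < 1 :> R by lra.
have cG := @continuous_gweight _ k.
have iG := integrable_gweight k0.
have ig : mu.-integrable `]- s, s[ (EFin \o g).
  apply: (@ge0_integrable_substitution_oo _ false _ _ _ _ _ _ _ ss N11 cG iG _ cF Fab FE dF cf).
  - by move=> u _; exact: powR_ge0.
  - by move=> v _; rewrite expr0 mul1r invr_ge0 ltW.
have gE := @integral_substitution_oo _ false _ _ _ _ _ _ _ ss N11 cG iG cF Fab FE dF cf ig.
rewrite expr0 mul1r in gE.
rewrite -gE.
transitivity (\int[mu]_(v in `](- s)%R, s[) (r `^ (k + 2^-1 - 1) * expR (- r) * g v)%:E)%E.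
  rewrite [RHS]integral_mkcond; apply: eq_integral => v _; rewrite patchE.
  rewrite /cut subr_gt0; case: ifPn => vr; last first.
    by rewrite ifN ?mulr0//; apply: contra vr => /set_mem/=; rewrite itvs.
  rewrite ifT; last by apply/mem_set; rewrite /= itvs.
  congr EFin; rewrite /g /gweight.
  have -> : r - v ^+ 2 = r * (1 - (v / s) ^+ 2).
    by rewrite -srE; field.
  have vs0 : 0 < 1 - (v / s) ^+ 2.
    by rewrite subr_gt0 exprMn exprVn srE ltr_pdivrMr// mul1r.
  rewrite powRM ?(ltW r0) ?(ltW vs0)//.
  have -> : k + 2^-1 - 1 = (k - 1) + 2^-1 by ring.
  rewrite (powRD _ (s := 2^-1)); last by rewrite (gt_eqF r0) implybT.
  by rewrite powR12_sqrt ?(ltW r0)// -/s; field.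
under eq_integral do rewrite EFinM.
rewrite integralZl//; rewrite [RHS]EFinM; congr (_ * _)%E.
by rewrite /Rintegral fineK//; exact: integrable_fin_num.
Qed.

(** Tonelli for e^(-r) (r - v^2)^(k-1) on the region r > v^2. Integrating in v first gives the left
    side by scaling; integrating in r first, with r = t + v^2, splits off the Gaussian integral and
    gives the right side. *)
Lemma eGamma_beta (k : R) : 0 < k ->
  (eGamma (k + 2^-1) * (\int[mu]_(c in `](-1)%R, 1%R[) gweight k c)%:E =
   (Num.sqrt pi)%:E * eGamma k)%E.
Proof.
move=> k0.
pose f (z : measurableTypeR R * measurableTypeR R) : \bar R :=
  (expR (- z.1) * cut k (z.1 - z.2 ^+ 2))%:E.
have mf : measurable_fun setT f.
  apply/measurable_EFinP; apply: measurable_funM.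
    apply: measurableT_comp; first exact: measurable_expR.
    by apply: measurableT_comp => //; exact: measurable_fst.
  apply: (measurableT_comp (mcut k)).
  apply: measurable_funB; first exact: measurable_fst.
  by apply: measurable_funX; exact: measurable_snd.
have f0 z : (0 <= f z)%E by rewrite lee_fin mulr_ge0 ?expR_ge0.
have := @fubini_tonelli _ _ _ _ R mu mu f mf f0.
rewrite (_ : (\int[mu]_r \int[mu]_v f (r, v) =
  eGamma (k + 2^-1) * (\int[mu]_(c in `](-1)%R, 1%R[) gweight k c)%:E)%E); last first.
  transitivity (\int[mu]_(r in `]0%R, +oo[) ((r `^ (k + 2^-1 - 1) * expR (- r))%:E *
      (\int[mu]_(c in `](-1)%R, 1%R[) gweight k c)%:E))%E.
    rewrite [RHS]integral_mkcond; apply: eq_integral => r _; rewrite patchE.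
    case: ifPn => [/set_mem/=|].
      by rewrite in_itv/= andbT => r0; rewrite inner_v.
    move=> /negP rn; apply: integral0_eq => v _; rewrite /f/= /cut ifN ?mulr0//.
    rewrite subr_gt0 -leNgt (@le_trans _ _ 0) ?sqr_ge0// leNgt.
    by apply/negP => r0; apply: rn; apply/mem_set; rewrite /= in_itv/= r0.
  rewrite ge0_integralZr//.
  - by apply/measurable_EFinP; exact: mGamma.
  - by move=> r _; rewrite lee_fin mulr_ge0 ?powR_ge0 ?expR_ge0.
  - by rewrite lee_fin ltW// gweight_int_gt0.
move=> ->.
transitivity (\int[mu]_v ((gauss_fun v)%:E * eGamma k))%E; last first.
  rewrite ge0_integralZr// ?integralT_gauss//.
  - by apply/measurable_EFinP; exact: measurable_gauss_fun.
  - by move=> v _; rewrite lee_fin gauss_fun_ge0.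
  - exact/ltW/eGamma_gt0.
apply: eq_integral => v _; rewrite /f/=.
rewrite -(@ge0_integral_shift _ (v ^+ 2)).
- transitivity (\int[mu]_(t in `]0%R, +oo[) ((gauss_fun v)%:E * (t `^ (k - 1) * expR (- t))%:E))%E.
    rewrite [RHS]integral_mkcond; apply: eq_integral => t _; rewrite patchE addrK /cut.
    case: ifPn => t0; last first.
      by rewrite ifN ?mulr0//; apply: contra t0 => /set_mem/=; rewrite in_itv/= andbT.
    rewrite ifT; last by apply/mem_set; rewrite /= in_itv/= t0.
    rewrite -EFinM; congr EFin; rewrite /gauss_fun opprD expRD; ring.
  rewrite ge0_integralZl//.
  - by apply/measurable_EFinP; exact: mGamma.
  - by move=> r _; rewrite lee_fin mulr_ge0 ?powR_ge0 ?expR_ge0.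
  - by rewrite lee_fin gauss_fun_ge0.
- apply/measurable_EFinP; apply: measurable_funM.
    by apply: measurableT_comp => //; exact: measurable_expR.
  by apply: (measurableT_comp (mcut k)); exact: measurable_funB.
- by move=> r; rewrite lee_fin mulr_ge0 ?expR_ge0.
Qed.

Lemma eGamma1_fin : (eGamma 1 < +oo)%E.
Proof.
rewrite /eGamma subrr.
under eq_integral do rewrite powRr0 mul1r.
rewrite integral_itv_obnd_cbnd; last first.
  by apply/measurable_EFinP/measurable_funTS; apply: measurableT_comp => //; exact: measurable_expR.
have dF (x : R) : is_derive x (1 : R) (fun x : R => - expR (- x)) (expR (- x)).
  have h := is_derive_expR (- x).
  have e := is_deriveNid x (1 : R).
  have := is_deriveN (is_derive1_comp (g := fun x : R => - x) h e).
  by rewrite mulrN1 opprK.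
rewrite (@ge0_continuous_FTC2y _ _ (fun x : R => - expR (- x)) 0 0).
- by rewrite ltry.
- by move=> x _; exact: expR_ge0.
- apply: continuous_subspaceT => x.
  by apply: continuous_comp; [exact: continuousN|exact: continuous_expR].
- rewrite -oppr0; apply: cvgN; exact: cvgr_expR.
- by move=> x _; have [] := dF x.
- apply: cvg_at_right_filter.
  have c0 : {for 0, continuous (fun x : R => - expR (- x))}.
    by apply: differentiable_continuous; apply/derivable1_diffP; have [] := dF 0.
  exact: c0.
- by move=> x _; rewrite derive1E; have [_ ->] := dF x.
Qed.

(** In [eGamma_beta] the two other factors are finite and positive, so both Gamma integrals are
    finite or both are infinite. *)
Lemma eGamma_finS (k : R) : 0 < k ->
  ((eGamma k < +oo) = (eGamma (k + 2^-1) < +oo))%E.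
Proof.
move=> k0; have := eGamma_beta k0.
have B0 := gweight_int_gt0 k0; set B := Rintegral _ _ _ in B0 *.
have p0 : 0 < Num.sqrt pi :> R by rewrite sqrtr_gt0 pi_gt0.
have g1 := eGamma_gt0 k; have g2 := eGamma_gt0 (k + 2^-1).
case: (eGamma k) g1 => [a| |]//; case: (eGamma (k + 2^-1)) g2 => [b| |]// _ _.
- by rewrite !ltry.
- by rewrite gt0_mulye ?lte_fin// -EFinM.
- by rewrite gt0_muley ?lte_fin// -EFinM.
Qed.

Lemma eGamma_fin (k : R) : 0 < k -> (eGamma k < +oo)%E.
Proof.
move=> k0.
have half n : (eGamma (1 + n%:R / 2) < +oo)%E.
  elim: n => [|n IH]; first by rewrite mul0r addr0; exact: eGamma1_fin.
  rewrite (_ : 1 + n.+1%:R / 2 = 1 + n%:R / 2 + 2^-1); last by rewrite -natr1; field.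
  by rewrite -eGamma_finS// ltr_pwDl// divr_ge0.
(* Two half steps lead from any k > 0 to k + 1, which is at least 1. *)
suff big a : 1 <= a -> (eGamma a < +oo)%E.
  rewrite eGamma_finS// eGamma_finS; last by rewrite addr_gt0.
  apply: big; lra.
(* For a >= 1 the integrand is dominated through t^(a-1) <= 1 + t^((n+1)/2), which bounds the
   integral by its values at 1 and at 1 + (n+1)/2. *)
move=> a1; pose n := Num.truncn (2 * (a - 1)).
have an : a - 1 <= n.+1%:R / 2.
  have := truncnS_gt (2 * (a - 1)); rewrite -/n; lra.
have := half n.+1.
have := eGamma1_fin.
move=> h1 h2; apply: (@le_lt_trans _ _ (eGamma 1 + eGamma (1 + n.+1%:R / 2))%E); last first.
  by rewrite lte_add_pinfty.
rewrite /eGamma -ge0_integralD//.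
- apply: ge0_le_integral => //.
  + by move=> t _; rewrite lee_fin mulr_ge0 ?powR_ge0 ?expR_ge0.
  + by apply/measurable_EFinP; exact: mGamma.
  + by apply: emeasurable_funD; apply/measurable_EFinP; exact: mGamma.
  + move=> t /=; rewrite in_itv/= andbT => t0.
    rewrite -EFinD lee_fin -mulrDl ler_wpM2r ?expR_ge0//.
    rewrite subrr powRr0 addrAC subrr add0r.
    have [t1|t1] := leP t 1.
      have : t `^ (a - 1) <= t `^ 0 by apply: ger_powR; [rewrite t0|lra].
      by rewrite powRr0 => h; rewrite (le_trans h)// lerDl powR_ge0.
    have : t `^ (a - 1) <= t `^ (n.+1%:R / 2) by apply: ler_powR => //; exact: ltW.
    by move=> h; rewrite (le_trans h)// lerDr.
- by move=> t _; rewrite lee_fin mulr_ge0 ?powR_ge0 ?expR_ge0.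
- by apply/measurable_EFinP; exact: mGamma.
- by move=> t _; rewrite lee_fin mulr_ge0 ?powR_ge0 ?expR_ge0.
- by apply/measurable_EFinP; exact: mGamma.
Qed.

(** The value is 1/2 and not 1 because z in [-pi, pi] covers each c twice, at z and at -z. *)
Lemma Gamma_beta (k : R) : 0 < k ->
  Gamma (k + 2^-1) / (2 * Gamma k * Num.sqrt pi) *
  \int[mu]_(c in `](-1)%R, 1%R[) gweight k c = 2^-1.
Proof.
move=> k0; have := eGamma_beta k0.
have Gfin a : 0 < a -> eGamma a = (Gamma a)%:E.
  move=> a0; rewrite /Gamma /Rintegral fineK// ge0_fin_numE; first exact: eGamma_fin.
  exact/ltW/eGamma_gt0.
have G0 : 0 < Gamma k by rewrite -lte_fin -Gfin// eGamma_gt0.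
have p0 : 0 < Num.sqrt pi :> R by rewrite sqrtr_gt0 pi_gt0.
rewrite !Gfin//; last by rewrite addr_gt0.
rewrite -!EFinM => -[E]; rewrite mulrAC E; field.
by rewrite !gt_eqF.
Qed.

End BetaGamma.

(** * Integration against the kernel *)

Section Reflection.
Variable R : realType.
Local Notation mu := (@lebesgue_measure R).

Lemma ge0_integral_reflect (f : R -> \bar R) (a b : R) :
  measurable_fun `](- b)%R, (- a)%R[ f ->
  {in `](- b)%R, (- a)%R[, forall y, (0 <= f y)%E} ->
  (\int[mu]_(x in `](- b)%R, (- a)%R[) f x = \int[mu]_(x in `]a, b[) f (- x)%R)%E.
Proof.
move=> mf f0.
have -> : `]a, b[%classic = (-%R : _ -> measurableTypeR R) @^-1` `](- b)%R, (- a)%R[.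
  by apply/seteqP; split => x /=; rewrite !in_itv/= ltrN2 ltrN2 andbC.
rewrite -ge0_integral_pushforward//=; last first.
  by move=> y /set_mem; exact: f0.
by apply: eq_measure_integral => //= A mA _; exact/esym/lebesgue_measureN.
Qed.

Lemma measurable_reflect (h : R -> R) (a b : R) :
  measurable_fun `]a, b[ (fun z => h (- z)) -> measurable_fun `](- b)%R, (- a)%R[ h.
Proof.
move=> mh.
have -> : h = (fun z => h (- z)) \o -%R by apply/funext => z /=; rewrite opprK.
apply: (@measurable_comp _ _ _ _ _ _ `]a, b[) => //.
by move=> _ [x + <-] /=; rewrite !in_itv/= ltrNr ltrNl andbC.
Qed.

Lemma integrable_reflect (h : R -> R) (a b : R) :
  mu.-integrable `]a, b[ (EFin \o (fun z => h (- z))) ->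
  mu.-integrable `](- b)%R, (- a)%R[ (EFin \o h).
Proof.
move=> /integrableP[/measurable_EFinP mh fin].
have mh' := measurable_reflect mh.
apply/integrableP; split; first exact/measurable_EFinP.
rewrite ge0_integral_reflect//.
by apply: measurableT_comp => //; exact/measurable_EFinP.
Qed.

(** Measurability suffices, since the positive and negative parts are reflected separately. *)
Lemma Rintegral_reflect (h : R -> R) (a b : R) :
  measurable_fun `](- b)%R, (- a)%R[ h ->
  \int[mu]_(x in `](- b)%R, (- a)%R[) h x = \int[mu]_(x in `]a, b[) h (- x).
Proof.
move=> mh; rewrite /Rintegral; congr fine.
rewrite integralE [RHS]integralE.
have me : measurable_fun `](- b)%R, (- a)%R[ (EFin \o h) by exact/measurable_EFinP.
have E1 := ge0_integral_reflect (measurable_funepos me) (fun y _ => funepos_ge0 _ y).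
have E2 := ge0_integral_reflect (measurable_funeneg me) (fun y _ => funeneg_ge0 _ y).
rewrite E1 E2; congr (_ - _)%E; apply: eq_integral => z _.
- exact/esym/(congr1 (@^~ z) (funepos_comp (EFin \o h) (-%R : R -> R))).
- exact/esym/(congr1 (@^~ z) (funeneg_comp (EFin \o h) (-%R : R -> R))).
Qed.

Lemma integrable_sym (h : R -> R) (p : R) : 0 < p ->
  measurable_fun [set: R] h ->
  mu.-integrable `]0%R, p[ (EFin \o h) ->
  mu.-integrable `]0%R, p[ (EFin \o (fun z => h (- z))) ->
  mu.-integrable `[(- p)%R, p] (EFin \o h).
Proof.
move=> p0 mh i1 /integrable_reflect; rewrite oppr0 => i2.
have mD (D : set (measurableTypeR R)) : measurable_fun D (fun x => `|(EFin \o h) x|)%E.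
  apply: measurableT_comp => //; apply/measurable_EFinP; exact: measurable_funTS.
apply/integrableP; split; first by apply/measurable_EFinP; exact: measurable_funTS.
rewrite integral_itv_bndoo//.
rewrite (@itv_bndbnd_setU _ _ _ (BRight 0)); [|by rewrite bnd_simp; lra|by rewrite bnd_simp; lra].
rewrite ge0_integral_setU//=; last first.
  apply/disj_setPS => y [/=]; rewrite 2!in_itv/= => /andP[_ yx] /andP[].
  by rewrite ltNge yx.
rewrite -integral_itv_bndo_bndc//.
move/integrableP: i1 => [_ f1]; move/integrableP: i2 => [_ f2].
exact: lte_add_pinfty.
all: exact: mD.
Qed.

Lemma Rintegral_sym (h : R -> R) (p : R) : 0 < p ->
  mu.-integrable `[(- p)%R, p] (EFin \o h) ->
  \int[mu]_(x in `[(- p)%R, p]) h x = \int[mu]_(x in `]0%R, p[) (h x + h (- x)).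
Proof.
move=> p0 ih.
have i1 : mu.-integrable `]0%R, p] (EFin \o h).
  by apply: integrableS ih => //; apply: subset_itv; rewrite bnd_simp; lra.
have i1' : mu.-integrable `]0%R, p[ (EFin \o h).
  by apply: integrableS i1 => //; apply: subset_itv; rewrite bnd_simp; lra.
have i2 : mu.-integrable `](- p)%R, 0%R] (EFin \o h).
  by apply: integrableS ih => //; apply: subset_itv; rewrite bnd_simp; lra.
have i2' : mu.-integrable `](- p)%R, 0%R[ (EFin \o h).
  by apply: integrableS i2 => //; apply: subset_itv; rewrite bnd_simp; lra.
have i3 : mu.-integrable `]0%R, p[ (EFin \o (fun z => h (- z))).
  rewrite -(opprK p) -[0]oppr0; apply: integrable_reflect.
  by move: i2'; apply: eq_integrable => // z _ /=; rewrite opprK.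
rewrite RintegralD//.
have := @Rintegral_itvB _ h (BLeft (- p)) (BRight p) 0 ih; rewrite !bnd_simp => /(_ _ _)E.
have -> : \int[mu]_(x in `[(- p)%R, p]) h x =
    \int[mu]_(x in `]0%R, p]) h x + \int[mu]_(x in `[(- p)%R, 0%R]) h x.
  by rewrite -E ?subrK//; lra.
rewrite -Rintegral_itv_bndo_bndc//; congr (_ + _).
rewrite -Rintegral_itv_obnd_cbnd// -Rintegral_itv_bndo_bndc//.
rewrite -[in LHS]oppr0 Rintegral_reflect//.
by rewrite oppr0; apply/measurable_EFinP; exact: measurable_int i2'.
Qed.

End Reflection.

(** * The kernel measure in the variable c *)

Section KernelIntegral.
Variables (R : realType) (k : R).
Hypothesis k_gt0 : 0 < k.
Local Notation mu := (@lebesgue_measure R).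

Definition gmean (p : {poly R}) : R :=
  (\int[mu]_(c in `](-1)%R, 1%R[) (p.[c] * gweight k c)) /
  \int[mu]_(c in `](-1)%R, 1%R[) gweight k c.

Lemma gmean_linear a p q : gmean (a *: p + q) = a * gmean p + gmean q.
Proof.
rewrite /gmean mulrA -mulrDl; congr (_ / _).
rewrite -RintegralZl//; last exact: integrable_poly_gweight.
rewrite -RintegralD//; last exact: integrable_poly_gweight.
- by apply: eq_Rintegral => c _; rewrite !hornerE/=; ring.
- have := integrable_poly_gweight k_gt0 (a *: p).
  by apply: eq_integrable => // c _ /=; rewrite !hornerE/= -!mulrA.
Qed.

Lemma gmean1 : gmean 1 = 1.
Proof.
rewrite /gmean -[RHS](@divff _ (\int[mu]_(c in `](-1)%R, 1%R[) gweight k c)).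
  by congr (_ / _); apply: eq_Rintegral => c _; rewrite hornerE mul1r.
by rewrite gt_eqF// gweight_int_gt0.
Qed.

Lemma gmean_ibp p : gmean ((1 - 'X^2) * p^`()) = 2 * k * gmean ('X * p).
Proof. by rewrite /gmean mulrA gweight_ibp. Qed.

Variables x y : R.
Hypothesis (hx : - pi <= x <= pi) (hy : - pi <= y <= pi).
Hypothesis sxy : sin x * sin y != 0.

Let b := sin x * sin y.
(** [cz] is the variable c solved from cos z = cos x cos y + c sin x sin y, and [rho] is chosen so
    that rho(z) |sin z| |dz| becomes C (1 - c^2)^(k-1) |dc| on the support. *)
Let cz (z : R) := (cos z - cos x * cos y) / b.
Let C := Gamma (k + 2^-1) / (2 * Gamma k * Num.sqrt pi).
Let rho (z : R) := if `|cz z| < 1 then C * gweight k (cz z) / `|b| else 0.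

Let b0 : 0 < `|b|. Proof. by rewrite normr_gt0. Qed.

Let sin_norm (t : R) : - pi <= t <= pi -> sin `|t| = `|sin t|.
Proof.
move=> /andP[h1 h2]; have [t0|t0] := leP 0 t.
  by rewrite (ger0_norm t0) ger0_norm// sin_ge0_pi// t0.
rewrite (ltr0_norm t0) sinN ler0_norm// -oppr_ge0 -sinN sin_ge0_pi//.
by rewrite oppr_ge0 ltW//= lerNl.
Qed.

(** On [-pi, pi] the sine of |x| is |sin x|, so the two bounds on cos z are cos x cos y - |b| and
    cos x cos y + |b|. *)
Lemma support_cz z :
  (cos (`|x| + `|y|) < cos z < cos (`|x| - `|y|)) = (`|cz z| < 1).
Proof.
rewrite cosD cosB !cos_norm !sin_norm// -normrM -/b /cz normf_div.
rewrite ltr_pdivrMr// mul1r ltr_norml; congr (_ && _).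
- by rewrite [RHS]ltrBrDr (addrC (- _)).
- by rewrite ltrBlDl.
Qed.

(** The product inside the power is b^2 (1 - c^2); the remaining powers of |b| and |sin z| cancel
    down to |sin z| / |b|, the Jacobian of the substitution. *)
Lemma kernel_weightE z : Wk k x y z * wk k z = rho z * `|sin z|.
Proof.
rewrite /Wk /rho /wk support_cz -/C -/b.
have [s0|s0] := eqVneq (sin z) 0.
  by rewrite s0 mulr0 eqxx mul0r normr0 mulr0.
rewrite mulf_neq0//=; case: ifPn => h; last by rewrite !mul0r.
have s1 : 0 < `|sin z| by rewrite normr_gt0.
have c0 : 0 <= 1 - cz z ^+ 2.
  by rewrite subr_ge0 -real_normK ?num_real// exprn_ile1// ltW.
have -> : (cos z - cos (x + y)) * (cos (x - y) - cos z) = `|b| ^+ 2 * (1 - cz z ^+ 2).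
  rewrite real_normK ?num_real// cosD cosB -/b.
  by rewrite /cz; move: sxy; rewrite -/b => ?; field.
rewrite powRM ?exprn_ge0// (normrM b) (powRM _ (ltW b0) (ltW s1)) -/(gweight k (cz z)).
have -> : (`|b| ^+ 2) `^ (k - 1) = `|b| `^ (2 * k - 1) / `|b|.
  rewrite -[`|b| ^+ 2]powR_mulrn// -powRrM.
  have -> : 2%:R * (k - 1) = (2 * k - 1) + -1 by ring.
  by rewrite powRD ?(gt_eqF b0) ?implybT// powR_inv1.
have -> : `|sin z| `^ (2 * k) = `|sin z| `^ (2 * k - 1) * `|sin z|.
  rewrite -{3}[`|sin z|]powRr1// -powRD; last by rewrite (gt_eqF s1) implybT.
  by congr (_ `^ _); ring.
have p1 := powR_gt0 (2 * k - 1) b0; have p2 := powR_gt0 (2 * k - 1) s1.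
by field; rewrite !gt_eqF.
Qed.

Let C_int : C * \int[mu]_(c in `](-1)%R, 1%R[) gweight k c = 2^-1.
Proof. exact: Gamma_beta. Qed.

Let C_ge0 : 0 <= C.
Proof.
have := C_int; have := gweight_int_gt0 k_gt0; set I := Rintegral _ _ _ => I0 E.
by rewrite -(pmulr_lge0 _ I0) E.
Qed.

Let rho_ge0 z : 0 <= rho z.
Proof. by rewrite /rho; case: ifP => // _; rewrite divr_ge0// mulr_ge0// powR_ge0. Qed.

Let mcos D : measurable_fun D (@cos R).
Proof. by apply: measurable_funTS; apply: continuous_measurable_fun; exact: continuous_cos. Qed.

Let msin D : measurable_fun D (@sin R).
Proof. by apply: measurable_funTS; apply: continuous_measurable_fun; exact: continuous_sin. Qed.

Let mcz D : measurable_fun D cz.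
Proof. by apply: measurable_funM => //; exact: measurable_funB. Qed.

Let mrho D : measurable_fun D rho.
Proof.
apply: measurable_funTS; apply: measurable_fun_ifT => //.
  by apply: measurable_fun_ltr => //; exact: measurableT_comp.
apply: measurable_funM => //; apply: measurable_funM => //.
apply: (measurableT_comp (measurable_powR _)); apply: measurable_funB => //.
exact: measurable_funX.
Qed.

Lemma integrable_kernel_poly (p : {poly R}) :
  mu.-integrable `]0%R, pi[ (EFin \o (fun z => p.[cz z] * (rho z * `|sin z|))) /\
  \int[mu]_(z in `]0%R, pi[) (p.[cz z] * (rho z * `|sin z|)) = gmean p / 2.
Proof.
have ap : cos (`|x| - `|y|) = cos x * cos y + `|b|.
  by rewrite cosB !cos_norm !sin_norm// -normrM.
have am : cos (`|x| + `|y|) = cos x * cos y - `|b|.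
  by rewrite cosD !cos_norm !sin_norm// -normrM.
(* These are the ends of the support inside [0, pi], where the cosine is decreasing and therefore
   swaps the two bounds. *)
pose z0 := acos (cos (`|x| - `|y|)); pose z1 := acos (cos (`|x| + `|y|)).
have itc (t : R) : -1 <= cos t <= 1 by rewrite cos_geN1 cos_le1.
have itc' (t : R) : cos t \in `[(-1), 1]%R by rewrite in_itv/=.
have cz0 : cos z0 = cos x * cos y + `|b| by rewrite acosK.
have cz1 : cos z1 = cos x * cos y - `|b| by rewrite acosK.
have z0i : z0 \in `[0, pi] by rewrite in_itv/= acos_ge0// acos_lepi.
have z1i : z1 \in `[0, pi] by rewrite in_itv/= acos_ge0// acos_lepi.
have z0_ge0 : 0 <= z0 by exact: acos_ge0.
have z1_le : z1 <= pi by exact: acos_lepi.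
have z01 : z0 < z1 by rewrite -ltr_cos// cz0 cz1 ltrD2l (lt_trans _ b0)// oppr_lt0.
have suppE z : z \in `]0, pi[ -> (`|cz z| < 1) = (z \in `]z0, z1[).
  rewrite in_itv/= => /andP[h1 h2].
  have zi : z \in `[0, pi] by rewrite in_itv/= !ltW.
  rewrite -support_cz ap am -cz0 -cz1 in_itv/= andbC.
  by rewrite ltr_cos// ltr_cos.
have sub z : z \in `]z0, z1[ -> z \in `]0, pi[.
  rewrite !in_itv/= => /andP[h1 h2].
  by rewrite (le_lt_trans z0_ge0 h1) (lt_le_trans h2 z1_le).
have cF : continuous cz.
  move=> z; apply: cvgM; last exact: cvg_cst.
  by apply: cvgB; [exact: continuous_cos|exact: cvg_cst].
have Fab : {in `]z0, z1[, forall z, cz z \in `]-1, 1[}.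
  by move=> z zi; rewrite in_itv/= -ltr_norml suppE// sub.
have dF : {in `]z0, z1[, forall z, is_derive z (1 : R) cz (- sin z / b)}.
  move=> z _.
  have h := is_deriveB (is_derive_cos z) (is_derive_cst (cos x * cos y) z (1 : R)).
  have -> : cz = b^-1 \*: (@cos R - cst (cos x * cos y)).
    by apply/funext => t; rewrite /cz /= mulrC.
  have -> : - sin z / b = b^-1 *: (- sin z - 0) by rewrite subr0 mulrC.
  exact: is_deriveZ.
have cf : {in `]z0, z1[, continuous (fun z => - sin z / b)}.
  move=> z _; apply: cvgM; last exact: cvg_cst.
  by apply: cvgN; exact: continuous_sin.
(* The derivative of c in z is - sin z / b, so the orientation is reversed exactly when b > 0. *)
pose sg := 0 < b.
have bE : `|b| = (-1) ^+ (~~ sg) * b.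
  rewrite /sg; have [h|h|h] := ltgtP 0 b.
  - by rewrite gtr0_norm// expr0 mul1r.
  - by rewrite ltr0_norm// expr1 mulN1r.
  - by have := b0; rewrite -h normr0 ltxx.
have bn0 : b != 0 by exact: sxy.
have FE : (cz z0, cz z1) = (if sg then (1, -1) else (-1, 1)).
  rewrite /cz cz0 cz1 bE addrC addKr addrC addKr.
  by case: sg bE => /= _; rewrite ?expr0 ?expr1; congr (_, _); field.
have N11 : -1 < 1 :> R by lra.
have cG := @continuous_gweight _ k.
have iG := integrable_gweight k_gt0.
have sb z : - sin z / b = (-1) ^+ sg * (sin z / `|b|).
  by rewrite bE; case: (sg) => /=; rewrite ?expr0 ?expr1; field.
have i1 : mu.-integrable `]z0, z1[ (EFin \o (fun z => gweight k (cz z) * (- sin z / b))).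
  apply: (@ge0_integrable_substitution_oo _ sg _ _ _ _ _ _ _ z01 N11 cG iG _ cF Fab FE dF cf).
  - by move=> u _; exact: powR_ge0.
  - move=> z /sub; rewrite in_itv/= => zi; rewrite sb mulrA -signr_addb addbb mul1r.
    by rewrite divr_ge0// sin_ge0_pi// !ltW//; case/andP: zi.
have [K pK] := horner_bounded p.
have mp D : measurable_fun D (fun z => p.[cz z]).
  apply: (@measurableT_comp _ _ _ _ _ _ (horner p)); [exact: measurable_poly|exact: mcz].
have i2 : mu.-integrable `]z0, z1[
    (EFin \o (fun z => p.[cz z] * (gweight k (cz z) * (- sin z / b)))).
  apply: (@integrable_bounded_mul _ _ _ (fun z => p.[cz z]) K) => //.
  - exact: mp.
  - by move=> z /= zi; apply: pK; rewrite ltW// suppE// sub.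
have E := @integral_substitution_oo _ sg (fun c => p.[c] * gweight k c) _ _ _ _ _ _ z01 N11
  _ (integrable_poly_gweight k_gt0 p) cF Fab FE dF cf.
have patchE' : {in `]0, pi[, (fun z => p.[cz z] * (rho z * `|sin z|)) =1
    (fun z => (-1) ^+ sg * C * (p.[cz z] * (gweight k (cz z) * (- sin z / b)))) \_ `]z0, z1[}.
  move=> z zi; rewrite patchE /rho suppE//.
  have [h|h] := boolP (z \in `]z0, z1[); last first.
    by rewrite mul0r mulr0 ifN//; apply: contra h => /set_mem.
  rewrite ifT; last exact/mem_set.
  rewrite sb (@ger0_norm _ (sin z)); last first.
    by apply: sin_ge0_pi; move: zi; rewrite in_itv/= => /andP[h1 h2]; rewrite !ltW.
  by case: (sg) => /=; rewrite ?expr0 ?expr1; field; rewrite gt_eqF.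
have i3 : mu.-integrable `]z0, z1[ (EFin \o (fun z => (-1) ^+ sg * C *
    (p.[cz z] * (gweight k (cz z) * (- sin z / b))))).
  exact: integrable_scale.
have subs : `]z0, z1[%classic `<=` `]0, pi[%classic by move=> z; exact: sub.
split.
  have : mu.-integrable `]0%R, pi[ (EFin \o ((fun z => (-1) ^+ sg * C *
    (p.[cz z] * (gweight k (cz z) * (- sin z / b)))) \_ `]z0, z1[)).
    by rewrite -restrict_EFin; apply/integrable_restrict => //; rewrite setIidr.
  by apply: eq_integrable => // z /set_mem zi /=; rewrite patchE'.
transitivity (\int[mu]_(z in `]0%R, pi[) (((fun z => (-1) ^+ sg * C *
    (p.[cz z] * (gweight k (cz z) * (- sin z / b)))) \_ `]z0, z1[) z)).
  by apply: eq_Rintegral => z /set_mem zi; rewrite patchE'.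
rewrite -Rintegral_mkcondr setIidr// RintegralZl//.
transitivity ((-1) ^+ sg * C * \int[mu]_(z in `]z0, z1[)
    (p.[cz z] * gweight k (cz z) * (- sin z / b))).
  by congr (_ * _); apply: eq_Rintegral => z _; rewrite mulrA.
rewrite E.
- rewrite mulrACA -signr_addb addbb mul1r /gmean.
  have I0 := gweight_int_gt0 k_gt0.
  have CE : C = 2^-1 / \int[mu]_(c in `](-1)%R, 1%R[) gweight k c.
    by rewrite -C_int mulfK// gt_eqF.
  by rewrite CE; field; rewrite gt_eqF.
- by move=> c ci; apply: cvgM; [exact: continuous_horner|exact: cG].
- by move: i2; apply: eq_integrable => // z _ /=; rewrite mulrA.
Qed.

(** The sign of sin z; with it the integrand is written without dividing by sin z. At a zero of the
    sine, |sin z| / sin z is also 0 because the inverse of 0 is 0. *)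
Let sgs (z : R) : R := if 0 < sin z then 1 else if sin z < 0 then -1 else 0.

Let msgs D : measurable_fun D sgs.
Proof.
apply: measurable_funTS; apply: measurable_fun_ifT => //.
  exact: measurable_fun_ltr.
by apply: measurable_fun_ifT => //; exact: measurable_fun_ltr.
Qed.

Let sgsE z : `|sin z| / sin z = sgs z.
Proof.
rewrite /sgs; have [h|h|<-] := ltgtP 0 (sin z).
- by rewrite gtr0_norm// divff// gt_eqF.
- by rewrite ltr0_norm// mulNr divff// lt_eqF.
- by rewrite invr0 mulr0.
Qed.

Let cz_sym z : cz (- z) = cz z. Proof. by rewrite /cz cosN. Qed.
Let rho_sym z : rho (- z) = rho z. Proof. by rewrite /rho cz_sym. Qed.

(** Folding [-pi, pi] onto ]0, pi[ flips the sign of 1 / sin z and keeps the rest of the weight, so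
    only N(z) - N(-z) remains; its factor 2 compensates the 1/2 of [integrable_kernel_poly]. The
    bound on [N] absorbs the zeros of sin z. *)
Lemma kernel_integral (N : R -> R) (K : R) (p : {poly R}) :
  continuous N -> 0 <= K -> (forall z, `|cz z| < 1 -> `|N z| <= K * `|sin z|) ->
  (forall z, N z - N (- z) = 2 * b * sin z * p.[cz z]) ->
  mu.-integrable `[(- pi)%R, pi]
    (EFin \o (fun z => N z / (b * sin z) * (Wk k x y z * wk k z))) /\
  \int[mu]_(z in `[(- pi)%R, pi]) (N z / (b * sin z) * (Wk k x y z * wk k z)) =
  gmean p.
Proof.
move=> cN K0 NK Np.
pose h z := b^-1 * (N z * (sgs z * rho z)).
have hE z : N z / (b * sin z) * (Wk k x y z * wk k z) = h z.
  rewrite kernel_weightE /h -sgsE.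
  by rewrite invfM; ring.
have pi0 := pi_gt0 R.
have mh : measurable_fun [set: R] h.
  apply: measurable_funM => //; apply: measurable_funM; last exact: measurable_funM.
  exact: continuous_measurable_fun.
have bound z : `|h z| <= `|b|^-1 * K * `|rho z * `|sin z| |.
  rewrite /h normrM normfV -(mulrA `|b|^-1) ler_wpM2l ?invr_ge0//.
  rewrite (normrM (rho z)) normr_id (ger0_norm (rho_ge0 z)).
  rewrite /rho; case: ifPn => hc; last by rewrite !(mul0r, mulr0) normr0.
  have sg1 : `|sgs z| <= 1 by rewrite /sgs; case: ifP => _; [|case: ifP => _]; rewrite ?normrN ?normr1 ?normr0.
  have r0 := rho_ge0 z; rewrite /rho hc in r0.
  move: r0; move: (C * _ / _) => r r0.
  rewrite !normrM (ger0_norm r0) mulrA (mulrC r) mulrA ler_wpM2r//.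
  by rewrite (le_trans _ (NK z hc))// ler_piMr.
have [iw _] := integrable_kernel_poly 1.
have iw' : mu.-integrable `]0%R, pi[ (EFin \o (fun z => rho z * `|sin z|)).
  by move: iw; apply: eq_integrable => // z _ /=; rewrite -polyC1 hornerC mul1r.
have iK : mu.-integrable `]0%R, pi[
    (EFin \o (fun z => `|b|^-1 * K * (rho z * `|sin z|))) by exact: integrable_scale.
have bK : 0 <= `|b|^-1 * K by rewrite mulr_ge0// invr_ge0.
have ih : mu.-integrable `[(- pi)%R, pi] (EFin \o h).
  apply: integrable_sym => //.
  - apply: (le_integrable _ _ _ iK) => //.
      by apply/measurable_EFinP; exact: measurable_funTS.
    by move=> z _ /=; rewrite lee_fin (normrM (`|b|^-1 * K)) (ger0_norm bK).
  - apply: (le_integrable _ _ _ iK) => //.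
      apply/measurable_EFinP; apply: measurable_funTS.
      exact: (measurableT_comp mh).
    move=> z _ /=; rewrite lee_fin (normrM (`|b|^-1 * K)) (ger0_norm bK).
    by rewrite (le_trans (bound _))// rho_sym sinN normrN.
split.
  by move: ih; apply: eq_integrable => // z _ /=; rewrite hE.
transitivity (\int[mu]_(z in `[(- pi)%R, pi]) h z).
  by apply: eq_Rintegral => z _; rewrite hE.
rewrite Rintegral_sym//.
transitivity (\int[mu]_(z in `]0%R, pi[) (((2%:P * p).[cz z]) * (rho z * `|sin z|))).
  apply: eq_Rintegral => z /set_mem/=; rewrite in_itv/= => zi.
  have s0 : 0 < sin z by exact: sin_gt0_pi.
  rewrite /h rho_sym /sgs sinN s0 oppr_gt0 oppr_lt0 s0 (lt_gtF s0) hornerM hornerC.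
  rewrite gtr0_norm//.
  have -> : N z = N (- z) + 2 * b * sin z * p.[cz z] by rewrite -Np; ring.
  by field; exact: sxy.
rewrite (integrable_kernel_poly _).2 mul_polyC -[2 *: p]addr0 gmean_linear.
have -> : gmean 0 = 0.
  by have := gmean_linear (-1) 0 0; rewrite scaler0 addr0; lra.
by field.
Qed.

End KernelIntegral.

(** * The product formula *)

Section ProductFormula.
Variables (R : realType) (k : R).
Hypothesis k_gt0 : 0 < k.
Local Notation mu := (@lebesgue_measure R).

Lemma mulComplex (a b c d : R) :
  Complex a b * Complex c d = Complex (a * c - b * d) (a * d + b * c).
Proof. by []. Qed.

Lemma mulComplexr (a b r : R) : Complex a b * r%:C = Complex (a * r) (b * r).
Proof. by rewrite mulComplex !mulr0 subr0 add0r. Qed.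

Lemma mulrComplex (a b r : R) : r%:C * Complex a b = Complex (r * a) (r * b).
Proof. by rewrite mulComplex !mul0r subr0 addr0. Qed.

Definition nsE (nu : R) (m : nat) (z : R) : R[i] :=
  Complex (gegen k m).[cos z] (sin z * (gegen k m)^`().[cos z] / nu).

(** Two of the three sines combine into cos(x - y) - cos z; the third one, multiplied by the
    exponential, gives the complex factor. With this form real and imaginary parts have numerators
    with visible parity in z. *)
Lemma calWE (x y z : R) : calW k x y z =
  ((cos (x - y) - cos z) / (sin x * sin y * sin z) * Wk k x y z)%:C *
  Complex (sin (x + y) + sin z) (cos z - cos (x + y)).
Proof.
rewrite /calW /cexpi mulrComplex mulComplexr mulrComplex.
have ss (p q : R) : 2 * (sin p * sin q) = cos (p - q) - cos (p + q).
  by rewrite cosB cosD; ring.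
have cs (p q : R) : 2 * (cos p * sin q) = sin (p + q) - sin (p - q).
  by rewrite sinB sinD; ring.
have D : 2 * (sin ((- x + y + z) / 2) * sin ((x - y + z) / 2)) = cos (x - y) - cos z.
  rewrite ss (_ : (- x + y + z) / 2 - (x - y + z) / 2 = - (x - y)); last by field.
  by rewrite (_ : (- x + y + z) / 2 + (x - y + z) / 2 = z) ?cosN//; field.
have S : 2 * (cos ((x + y - z) / 2) * sin ((x + y + z) / 2)) = sin (x + y) + sin z.
  rewrite cs (_ : (x + y - z) / 2 - (x + y + z) / 2 = - z); last by field.
  by rewrite (_ : (x + y - z) / 2 + (x + y + z) / 2 = x + y) ?sinN ?opprK//; field.
have V : 2 * (sin ((x + y - z) / 2) * sin ((x + y + z) / 2)) = cos z - cos (x + y).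
  rewrite ss (_ : (x + y - z) / 2 - (x + y + z) / 2 = - z); last by field.
  by rewrite (_ : (x + y - z) / 2 + (x + y + z) / 2 = x + y) ?cosN//; field.
by rewrite -D -S -V; congr Complex; ring.
Qed.

Variables x y : R.
Hypothesis (hx : - pi <= x <= pi) (hy : - pi <= y <= pi).
Hypothesis sxy : sin x * sin y != 0.

Let b := sin x * sin y.
Let a := cos x * cos y.
Let D (z : R) := cos (x - y) - cos z.
Let V (z : R) := cos z - cos (x + y).
Let S := sin (x + y).

(** On the support u = cos z lies between p = cos(x - y) and q = cos(x + y), both in [-1, 1]. If q
    <= u <= p then |p - u| <= 1 - u, |u - q| <= 1 + u and 1 - q^2 <= 2 (1 + u), so each product is
    controlled by 1 - u^2, the square of sin z; the other order is symmetric. *)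
Let support_bounds z : `|(cos z - a) / b| < 1 ->
  [/\ `|D z * S| <= 2 * `|sin z|, `|D z| <= 2 & `|D z * V z| <= `|sin z|].
Proof.
rewrite normf_div ltr_pdivrMr ?normr_gt0// mul1r /D /V /S => h.
have pE : cos (x - y) = a + b by rewrite cosB.
have qE : cos (x + y) = a - b by rewrite cosD.
have [p1 p2] : -1 <= cos (x - y) /\ cos (x - y) <= 1 by rewrite cos_geN1 cos_le1.
have [q1 q2] : -1 <= cos (x + y) /\ cos (x + y) <= 1 by rewrite cos_geN1 cos_le1.
have [u1 u2] : -1 <= cos z /\ cos z <= 1 by rewrite cos_geN1 cos_le1.
have Suq : sin (x + y) ^+ 2 = 1 - cos (x + y) ^+ 2 by exact: sin2cos2.
have Szq : sin z ^+ 2 = 1 - cos z ^+ 2 by exact: sin2cos2.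
have ord : (cos (x + y) <= cos z /\ cos z <= cos (x - y)) \/
           (cos (x - y) <= cos z /\ cos z <= cos (x + y)).
  move: h; rewrite pE qE; have [b0|b0] := leP 0 b.
    by rewrite (ger0_norm b0) ltr_norml => /andP[h1 h2]; left; split; lra.
  by rewrite (ltr0_norm b0) ltr_norml => /andP[h1 h2]; right; split; lra.
move: p1 p2 q1 q2 u1 u2 ord Suq Szq {h pE qE}.
move: (cos (x - y)) (cos (x + y)) (cos z) (sin (x + y)) (sin z) => p q u s t.
move=> p1 p2 q1 q2 u1 u2 ord sE tE.
have pu : `|p - u| <= 2 by rewrite ler_norml; apply/andP; split; lra.
have key1 : (p - u) ^+ 2 * s ^+ 2 <= 4 * t ^+ 2.
  rewrite sE tE; case: ord => [[e5 e6]|[e5 e6]].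
    have -> : 1 - q ^+ 2 = (1 - q) * (1 + q) by ring.
    have e1 : (p - u) ^+ 2 <= (1 - u) ^+ 2 by rewrite ler_sqr ?nnegrE; lra.
    have e2 : (1 - q) * (1 + q) <= 2 * (1 + u) by apply: ler_pM; lra.
    apply: (le_trans (ler_pM _ _ e1 e2)); [exact: sqr_ge0|by apply: mulr_ge0; lra|].
    have -> : (1 - u) ^+ 2 * (2 * (1 + u)) = (1 - u) * (2 * (1 - u ^+ 2)) by ring.
    have w0 : 0 <= 1 - u ^+ 2 by rewrite (_ : _ - _ = (1 - u) * (1 + u)) ?mulr_ge0; [|lra|lra|ring].
    have : (1 - u) * (2 * (1 - u ^+ 2)) <= 2 * (2 * (1 - u ^+ 2)).
      by apply: ler_wpM2r; lra.
    by move=> h; apply: (le_trans h); lra.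
  have -> : 1 - q ^+ 2 = (1 + q) * (1 - q) by ring.
  have e1 : (p - u) ^+ 2 <= (1 + u) ^+ 2 by rewrite -sqrrN ler_sqr ?nnegrE; lra.
  have e2 : (1 + q) * (1 - q) <= 2 * (1 - u) by apply: ler_pM; lra.
  apply: (le_trans (ler_pM _ _ e1 e2)); [exact: sqr_ge0|by apply: mulr_ge0; lra|].
  have -> : (1 + u) ^+ 2 * (2 * (1 - u)) = (1 + u) * (2 * (1 - u ^+ 2)) by ring.
  have w0 : 0 <= 1 - u ^+ 2 by rewrite (_ : _ - _ = (1 - u) * (1 + u)) ?mulr_ge0; [|lra|lra|ring].
  have : (1 + u) * (2 * (1 - u ^+ 2)) <= 2 * (2 * (1 - u ^+ 2)).
    by apply: ler_wpM2r; lra.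
  by move=> h; apply: (le_trans h); lra.
have t1 : `|t| <= 1.
  rewrite -(@ler_pXn2r _ 2)// ?nnegrE// real_normK ?num_real// expr1n tE.
  by rewrite gerBl sqr_ge0.
split => //.
- rewrite -(@ler_pXn2r _ 2)// ?nnegrE ?mulr_ge0// exprMn !real_normK ?num_real//.
  by rewrite exprMn (le_trans key1)// (_ : 2 ^+ 2 = 4)//; ring.
- apply: (@le_trans _ _ (`|t| ^+ 2)); last by rewrite expr2 ler_piMr.
  rewrite real_normK ?num_real// tE (_ : 1 - u ^+ 2 = (1 - u) * (1 + u)); last by ring.
  rewrite normrM; case: ord => [[e5 e6]|[e5 e6]].
    by rewrite !ger0_norm; [apply: ler_pM; lra|lra|lra].
  by rewrite !ler0_norm; [rewrite mulrC; apply: ler_pM; lra|lra|lra].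
Qed.

Variables (nu : R) (m : nat).
Hypothesis nu0 : nu != 0.
(** The roots are nu = m and nu = - (m + 2k), the values for n > 0 and n <= 0, so one computation
    serves both. *)
Hypothesis nuE : nu * (nu + 2 * k) = m%:R * (m%:R + 2 * k).

Let A := gegen k m.
Let B := A^`().
Let f1 (z : R) := A.[cos z].
Let f2 (z : R) := sin z * B.[cos z] / nu.
Let N1 (z : R) := f1 z * (D z * (S + sin z)) - f2 z * (D z * V z).
Let N2 (z : R) := f1 z * (D z * V z) + f2 z * (D z * (S + sin z)).

Let u : {poly R} := a%:P + b *: 'X.
(** [p1] and [p2] are N1(z) - N1(-z) and N2(z) - N2(-z) divided by 2 b sin z, written in c by means
    of D = b (1 - c) and V = b (1 + c). *)
Let p1 : {poly R} := (1 - 'X) * (A \Po u) - (b / nu) *: ((1 - 'X^2) * (B \Po u)).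
Let p2 : {poly R} := (S / nu) *: ((1 - 'X) * (B \Po u)).

Let integrandE z : nsE nu m z * calW k x y z * (wk k z)%:C =
  Complex (N1 z / (b * sin z) * (Wk k x y z * wk k z))
          (N2 z / (b * sin z) * (Wk k x y z * wk k z)).
Proof.
rewrite calWE /nsE /N1 /N2 /f1 /f2 /D /V /S -/A -/B -/b.
by apply/eqP; rewrite eq_complex/=; apply/andP; split; apply/eqP; ring.
Qed.

Let cont_horner_cos (p : {poly R}) : continuous (fun z : R => p.[cos z]).
Proof.
move=> z; apply: (@continuous_comp _ _ _ (@cos R) (horner p)).
  exact: continuous_cos.
exact: continuous_horner.
Qed.

Let cf1 : continuous f1. Proof. exact: cont_horner_cos. Qed.

Let cf2 : continuous f2.
Proof.
move=> z; apply: cvgM; last exact: cvg_cst.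
by apply: cvgM; [exact: continuous_sin|exact: cont_horner_cos].
Qed.

Let cD : continuous D.
Proof. by move=> z; apply: cvgB; [exact: cvg_cst|exact: continuous_cos]. Qed.

Let cV : continuous V.
Proof. by move=> z; apply: cvgB; [exact: continuous_cos|exact: cvg_cst]. Qed.

Let cDV : continuous (fun z => D z * V z).
Proof. by move=> z; apply: cvgM; [exact: cD|exact: cV]. Qed.

Let cDS : continuous (fun z => D z * (S + sin z)).
Proof.
move=> z; apply: cvgM; first exact: cD.
by apply: cvgD; [exact: cvg_cst|exact: continuous_sin].
Qed.

Let bound : exists2 K : R, 0 <= K & forall z, `|(cos z - a) / b| < 1 ->
  `|N1 z| <= K * `|sin z| /\ `|N2 z| <= K * `|sin z|.
Proof.
have [KA hA] := horner_bounded A; have [KB hB] := horner_bounded (nu^-1 *: B).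
have KA0 : 0 <= KA by apply: le_trans (hA 0 _); rewrite ?normr0.
have KB0 : 0 <= KB by apply: le_trans (hB 0 _); rewrite ?normr0.
exists (4 * KA + 4 * KB); first by lra.
move=> z /support_bounds[h1 h2 h3].
have cz := cos_max z; have sz := sin_max z.
have F1 : `|f1 z| <= KA by exact: hA.
have F2 : `|f2 z| <= KB.
  rewrite /f2 -mulrA normrM (le_trans _ (hB _ cz))// hornerZ mulrC (mulrC _ nu^-1).
  by rewrite ler_piMr.
have DS : `|D z * (S + sin z)| <= 4 * `|sin z|.
  rewrite mulrDr (le_trans (ler_normD _ _))// (_ : 4 * _ = 2 * `|sin z| + 2 * `|sin z|); last by ring.
  by rewrite lerD// normrM ler_wpM2r.
have N0 : 0 <= `|sin z| by [].
have E1 (r t K L : R) : 0 <= r -> 0 <= t -> r <= K -> t <= L -> r * t <= K * L.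
  by move=> *; apply: ler_pM.
split.
- rewrite /N1 (le_trans (ler_normB _ _))// (normrM (f1 z)) (normrM (f2 z)).
  have e1 := E1 _ _ _ _ (normr_ge0 _) (normr_ge0 _) F1 DS.
  have e2 := E1 _ _ _ _ (normr_ge0 _) (normr_ge0 _) F2 h3.
  rewrite (le_trans (lerD e1 e2))//.
  by have := mulr_ge0 KB0 N0; nra.
- rewrite /N2 (le_trans (ler_normD _ _))// (normrM (f1 z)) (normrM (f2 z)).
  have e1 := E1 _ _ _ _ (normr_ge0 _) (normr_ge0 _) F1 h3.
  have e2 := E1 _ _ _ _ (normr_ge0 _) (normr_ge0 _) F2 DS.
  rewrite (le_trans (lerD e1 e2))//.
  by have := mulr_ge0 KA0 N0; nra.
Qed.

Let comp_cz (p : {poly R}) z : (p \Po u).[(cos z - a) / b] = p.[cos z].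
Proof.
rewrite horner_comp /u; congr (_.[_]); rewrite !hornerE/=.
by move: sxy; rewrite -/b => ?; field.
Qed.

Lemma nsE_product :
  cintegrable `[(- pi)%R, pi] (fun z => nsE nu m z * calW k x y z * (wk k z)%:C) /\
  nsE nu m x * nsE nu m y =
  cint `[(- pi)%R, pi] (fun z => nsE nu m z * calW k x y z * (wk k z)%:C).
Proof.
have [K K0 hK] := bound.
have bn0 : b != 0 by exact: sxy.
have DE z : D z = b * (1 - (cos z - a) / b) by rewrite /D cosB -/a -/b; field.
have VE z : V z = b * (1 + (cos z - a) / b) by rewrite /V cosD -/a -/b; field.
have cN1 : continuous N1.
  by move=> z; apply: cvgB; apply: cvgM; [exact: cf1|exact: cDS|exact: cf2|exact: cDV].
have cN2 : continuous N2.
  by move=> z; apply: cvgD; apply: cvgM; [exact: cf1|exact: cDV|exact: cf2|exact: cDS].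
have e5 z : N1 z - N1 (- z) = 2 * b * sin z * p1.[(cos z - a) / b].
  rewrite /p1 hornerD hornerN hornerZ !hornerM !comp_cz.
  rewrite /N1 /f1 /f2 /D /V cosN sinN -/(D z) -/(V z) DE VE !hornerE/=.
  by move: (A.[cos z]) (B.[cos z]) ((cos z - a) / b) => P Q c; rewrite /b; field.
have e6 z : N2 z - N2 (- z) = 2 * b * sin z * p2.[(cos z - a) / b].
  rewrite /p2 hornerZ !hornerM !comp_cz.
  rewrite /N2 /f1 /f2 /D /V cosN sinN -/(D z) -/(V z) DE VE !hornerE/=.
  by move: (A.[cos z]) (B.[cos z]) ((cos z - a) / b) => P Q c; rewrite /b; field.
have [i1 I1] := kernel_integral k_gt0 hx hy sxy cN1 K0 (fun z h => (hK z h).1) e5.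
have [i2 I2] := kernel_integral k_gt0 hx hy sxy cN2 K0 (fun z h => (hK z h).2) e6.
rewrite (funext integrandE); split; first by split; [exact: i1|exact: i2].
rewrite /cint/= I1 I2.
have lin := gmean_linear k_gt0.
have [P1 P2 P3 P4] := gegen_product k_gt0 lin (gmean1 k_gt0) (gmean_ibp k_gt0)
  (sin2cos2 x) (sin2cos2 y) m.
move: P1 P2 P3 P4; rewrite -/a -/b -/u -/A -/B => P1 P2 P3 P4.
have M0 : gmean k 0 = 0 by have := lin (-1) 0 0; rewrite scaler0 addr0; lra.
have MZ r p : gmean k (r *: p) = r * gmean k p by rewrite -[r *: p]addr0 lin M0 addr0.
have MD p q : gmean k (p + q) = gmean k p + gmean k q.
  by rewrite -[p in LHS]scale1r lin mul1r.
have MN p : gmean k (- p) = - gmean k p by rewrite -scaleN1r MZ mulN1r.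
(* Integration by parts for A(u) turns the term with 1 - c^2 into another multiple of M(c A(u)). The
   total coefficient is then - (nu + 2k) / nu, which [nuE] and the second identity of
   [gegen_product] convert into the product of the imaginary parts. *)
have ibp : b * gmean k ((1 - 'X^2) * (B \Po u)) = 2 * k * gmean k ('X * (A \Po u)).
  rewrite -gmean_ibp// -MZ; congr gmean.
  rewrite deriv_comp /u derivD derivC derivZ derivX add0r -!mul_polyC -/B; ring.
rewrite /nsE mulComplex -/A -/B; congr Complex.
- rewrite /p1 MD MN MZ mulrBl mul1r MD MN P1.
  have {}P2 : gmean k ('X * (A \Po u)) * (nu * (nu + 2 * k)) = b * B.[cos x] * B.[cos y].
    by rewrite nuE mulrC.
  have -> : b / nu * gmean k ((1 - 'X^2) * (B \Po u)) =
      2 * k * gmean k ('X * (A \Po u)) / nu by rewrite -ibp; ring.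
  have -> : sin x * B.[cos x] / nu * (sin y * B.[cos y] / nu) =
      b * B.[cos x] * B.[cos y] / nu ^+ 2 by rewrite /b; field.
  by rewrite -P2; field.
(* Expanding sin(x + y) makes this mean the sum of the third and fourth identities. *)
- rewrite /p2 MZ mulrBl mul1r MD MN /S sinD.
  have -> : (sin x * cos y + cos x * sin y) / nu *
      (gmean k (B \Po u) - gmean k ('X * (B \Po u))) =
      ((sin x * cos y * gmean k (B \Po u) - cos x * sin y * gmean k ('X * (B \Po u))) +
       (cos x * sin y * gmean k (B \Po u) - sin x * cos y * gmean k ('X * (B \Po u)))) / nu.
    by ring.
  by rewrite P3 P4; ring.
Qed.

End ProductFormula.

(** * Orthogonality *)

Section Orthogonality.
Variables (R : realType) (k : R).
Hypothesis k_gt0 : 0 < k.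
Local Notation mu := (@lebesgue_measure R).

Lemma continuous_wk : continuous (wk k).
Proof.
move=> z; apply: (@continuous_comp _ _ _ (@sin R) (fun t => `|t| `^ (2 * k))).
  exact: continuous_sin.
by apply: continuous_norm_powR; rewrite mulr_gt0.
Qed.

Lemma integrable_continuous_itv (h : R -> R) (a b : R) : continuous h ->
  mu.-integrable `[a, b] (EFin \o h).
Proof.
move=> ch; apply: continuous_compact_integrable; first exact: segment_compact.
exact: continuous_subspaceT.
Qed.

Lemma integrable_wk (h : R -> R) : continuous h ->
  mu.-integrable `]0%R, pi[ (EFin \o (fun z => h z * wk k z)).
Proof.
move=> ch.
have ih : mu.-integrable `[0%R, pi] (EFin \o (fun z => h z * wk k z)).
  apply: integrable_continuous_itv => z.
  by apply: cvgM; [exact: ch|exact: continuous_wk].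
by apply: integrableS ih => //; exact: subset_itv_oo_cc.
Qed.

Definition wint (h : R -> R) : R := \int[mu]_(z in `]0%R, pi[) (h z * wk k z).

Lemma wint_lin (r : R) (f g : R -> R) : continuous f -> continuous g ->
  wint (fun z => r * f z + g z) = r * wint f + wint g.
Proof.
move=> cf cg; rewrite /wint -RintegralZl//; last exact: integrable_wk.
rewrite -RintegralD//; last exact: integrable_wk.
- by apply: eq_Rintegral => z _; ring.
- by apply: integrable_scale => //; exact: integrable_wk.
Qed.

Lemma eq_wint (f g : R -> R) : f =1 g -> wint f = wint g.
Proof. by move=> fg; apply: eq_Rintegral => z _; rewrite fg. Qed.

(** The weighted integrand is the derivative of g(z) sin z (sin z)^(2k), which vanishes at 0 and
    pi. *)
Lemma wint_ibp (g g' : R -> R) : continuous g -> continuous g' ->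
  (forall z, is_derive z (1 : R) g (g' z)) ->
  wint (fun z => sin z * g' z + (2 * k + 1) * cos z * g z) = 0.
Proof.
move=> cg cg' dg.
have k2 : 0 < 2 * k by rewrite mulr_gt0.
have ch : continuous (fun z : R => sin z * g' z + (2 * k + 1) * cos z * g z).
  move=> z; apply: cvgD; apply: cvgM => //.
  - exact: continuous_sin.
  - exact: cg'.
  - by apply: cvgM; [exact: cvg_cst|exact: continuous_cos].
  - exact: cg.
rewrite /wint (@integrable_FTC2_oo _ _ (fun z => g z * sin z * (sin z) `^ (2 * k))).
- by rewrite sin0 sinpi !mulr0 !mul0r subrr.
- exact: pi_gt0.
- apply: (@eq_within_continuous _ _ (fun z => g z * sin z * wk k z)).
    move=> z /set_mem/=; rewrite in_itv/= => zi.
    by rewrite /wk ger0_norm// sin_ge0_pi.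
  move=> z; apply: cvgM; last exact: continuous_wk.
  by apply: cvgM; [exact: cg|exact: continuous_sin].
- move=> z; rewrite in_itv/= => zi; have s0 : 0 < sin z by exact: sin_gt0_pi.
  have h1 := is_derive1_powR (2 * k) s0.
  have h2 := is_derive1_comp (g := @sin R) h1 (is_derive_sin z).
  have h3 := is_deriveM (dg z) (is_derive_sin z).
  have [h4 h5] := is_deriveM h3 h2; split => //.
  rewrite [LHS]h5 /wk gtr0_norm// /GRing.scale/=.
  rewrite -(mulr_powRB1 (ltW s0) k2) (_ : (g * @sin R) z = g z * sin z)//; ring.
- move=> z _; apply: cvgM; [exact: ch|exact: continuous_wk].
- exact: integrable_wk.
Qed.

Let cts (p : {poly R}) : continuous (fun z : R => p.[cos z]).
Proof.
move=> z; apply: (@continuous_comp _ _ _ (@cos R) (horner p)).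
  exact: continuous_cos.
exact: continuous_horner.
Qed.

Let ccos t : continuous (fun z : R => cos (t * z)).
Proof.
move=> z; apply: (@continuous_comp _ _ _ (fun z : R => t * z) (@cos R)).
  by apply: cvgM; [exact: cvg_cst|exact: cvg_id].
exact: continuous_cos.
Qed.

Let csin t : continuous (fun z : R => sin (t * z)).
Proof.
move=> z; apply: (@continuous_comp _ _ _ (fun z : R => t * z) (@sin R)).
  by apply: cvgM; [exact: cvg_cst|exact: cvg_id].
exact: continuous_sin.
Qed.

Let fa m t (z : R) := (gegen k m).[cos z] * cos (t * z).
Let fb m t (z : R) := sin z * (gegen k m)^`().[cos z] * sin (t * z).

Let cfa m t : continuous (fa m t).
Proof. by move=> z; apply: cvgM; [exact: cts|exact: ccos]. Qed.

Let cfb m t : continuous (fb m t).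
Proof.
move=> z; apply: cvgM; last exact: csin.
by apply: cvgM; [exact: continuous_sin|exact: cts].
Qed.

Definition wcos m t : R := wint (fa m t).
Definition wsin m t : R := wint (fb m t).

Lemma wcosN m t : wcos m (- t) = wcos m t.
Proof. by apply: eq_wint => z; rewrite /fa mulNr cosN. Qed.

Lemma wsinN m t : wsin m (- t) = - wsin m t.
Proof.
have -> : - wsin m t = -1 * wint (fb m t) + wint (fun=> 0).
  rewrite [wint (fun=> 0)](_ : _ = 0) ?addr0 ?mulN1r//.
  by rewrite /wint; under eq_Rintegral do rewrite mul0r; rewrite Rintegral_cst// mul0r.
rewrite -wint_lin//; first by apply: eq_wint => z; rewrite /fb mulNr sinN; ring.
by move=> z; exact: cvg_cst.
Qed.

Let clin r (f g : R -> R) : continuous f -> continuous g ->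
  continuous (fun z => r * f z + g z).
Proof.
move=> cf cg z; apply: cvgD; last exact: cg.
by apply: cvgM; [exact: cvg_cst|exact: cf].
Qed.

Let wint4 (r1 r2 r3 r4 : R) (f1 f2 f3 f4 : R -> R) :
  continuous f1 -> continuous f2 -> continuous f3 -> continuous f4 ->
  wint (fun z => r1 * f1 z + (r2 * f2 z + (r3 * f3 z + (r4 * f4 z + 0)))) =
  r1 * wint f1 + r2 * wint f2 + r3 * wint f3 + r4 * wint f4.
Proof.
move=> c1 c2 c3 c4.
have c0 : continuous (fun _ : R => 0 : R) by move=> z; exact: cvg_cst.
have w0 : wint (fun=> 0) = 0.
  by rewrite /wint; under eq_Rintegral do rewrite mul0r; rewrite Rintegral_cst// mul0r.
rewrite wint_lin//; last by do 3 (apply: clin => //).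
rewrite wint_lin//; last by do 2 (apply: clin => //).
rewrite wint_lin//; last by apply: clin.
by rewrite wint_lin// w0; ring.
Qed.

Let cosS t (z : R) : cos ((t + 1) * z) = cos (t * z) * cos z - sin (t * z) * sin z.
Proof. by rewrite mulrDl mul1r cosD. Qed.
Let cosP t (z : R) : cos ((t - 1) * z) = cos (t * z) * cos z + sin (t * z) * sin z.
Proof. by rewrite mulrBl mul1r cosB. Qed.
Let sinS t (z : R) : sin ((t + 1) * z) = sin (t * z) * cos z + cos (t * z) * sin z.
Proof. by rewrite mulrDl mul1r sinD. Qed.
Let sinP t (z : R) : sin ((t - 1) * z) = sin (t * z) * cos z - cos (t * z) * sin z.
Proof. by rewrite mulrBl mul1r sinB. Qed.

(** Up to a factor 2, the pairing of [nsE] for nu = - (m + 2k) with e^(itz). *)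
Definition wneg m t : R := wcos m t - wsin m t / (m%:R + 2 * k).

(** Product-to-sum formulas turn the ladder into a recurrence that sees degree m only through
    [wneg], so the induction can run on [wneg] alone. *)
Lemma wcosS m t : wcos m.+1 t = (wneg m (t + 1) + wneg m (1 - t)) / 2.
Proof.
have N0 := gegen_denom_neq0 k_gt0 m.
rewrite /wneg -[1 - t]opprB wcosN wsinN.
transitivity (2^-1 * wcos m (t + 1) + 2^-1 * wcos m (t - 1) +
  (- (2 * (m%:R + 2 * k))^-1) * wsin m (t + 1) + (2 * (m%:R + 2 * k))^-1 * wsin m (t - 1)).
  rewrite -wint4//; apply: eq_wint => z.
  rewrite /fa /fb gegenS_eval -sin2cos2 cosS cosP sinS sinP.
  by field.
by field.
Qed.

Lemma wsinS m t : wsin m.+1 t = m.+1%:R * (wneg m (1 - t) - wneg m (t + 1)) / 2.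
Proof.
have N0 := gegen_denom_neq0 k_gt0 m.
rewrite /wneg -[1 - t]opprB wcosN wsinN.
transitivity ((- (m.+1%:R / 2)) * wcos m (t + 1) + m.+1%:R / 2 * wcos m (t - 1) +
  (m.+1%:R / (2 * (m%:R + 2 * k))) * wsin m (t + 1) +
  (m.+1%:R / (2 * (m%:R + 2 * k))) * wsin m (t - 1)).
  rewrite -wint4//; apply: eq_wint => z.
  rewrite /fa /fb deriv_gegenS_eval// cosS cosP sinS sinP.
  by move: m.+1%:R => n; field.
by move: m.+1%:R => n; field.
Qed.

(** Obtained from [wint_ibp] with g(z) = A_m(cos z) cos(tz); it supplies the extreme frequency,
    which the recurrence in the degree does not reach. *)
Lemma wsin_ibp m t : wsin m (t + 1) - wsin m (t - 1) =
  (t + 2 * k + 1) * wcos m (t + 1) - (t - 2 * k - 1) * wcos m (t - 1).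
Proof.
pose g' (z : R) := - sin z * (gegen k m)^`().[cos z] * cos (t * z) -
  t * ((gegen k m).[cos z] * sin (t * z)).
have cg' : continuous g'.
  move=> z; apply: cvgB.
    apply: cvgM; last exact: ccos.
    by apply: cvgM; [apply: cvgN; exact: continuous_sin|exact: cts].
  by apply: cvgM; [exact: cvg_cst|apply: cvgM; [exact: cts|exact: csin]].
have dg z : is_derive z (1 : R) (fa m t) (g' z).
  have h1 := is_derive1_comp (g := @cos R) (is_derive_poly (gegen k m) (cos z)) (is_derive_cos z).
  have h2 : is_derive z (1 : R) (fun z : R => t * z) t.
    by have := is_deriveZ t (is_derive_id z (1 : R)); rewrite /GRing.scale/= mulr1.
  have h3 := is_derive1_comp (g := fun z : R => t * z) (is_derive_cos (t * z)) h2.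
  have [h4 h5] := is_deriveM h1 h3; split => //.
  by rewrite [LHS]h5 /g' /GRing.scale/=; ring.
have := wint_ibp (@cfa m t) cg' dg.
have -> : wint (fun z => sin z * g' z + (2 * k + 1) * cos z * fa m t z) =
    (- 2^-1) * wsin m (t + 1) + 2^-1 * wsin m (t - 1) +
    ((t + 2 * k + 1) / 2) * wcos m (t + 1) + (- ((t - 2 * k - 1) / 2)) * wcos m (t - 1).
  rewrite -wint4//; apply: eq_wint => z.
  by rewrite /fa /fb /g' cosS cosP sinS sinP; field.
lra.
Qed.

(** The frequencies are m, m - 2, ..., 2 - m: exactly those below n = -m in the order, with m
    included and -m excluded. *)
Lemma wneg_eq0 m l : (l < m)%N -> wneg m (m%:R - 2 * l%:R) = 0.
Proof.
elim: m l => // m IH l lm.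
(* Interior frequencies of degree m + 1: both arguments produced by the recurrence stay within the
   range of the induction hypothesis. *)
have low j : (0 < j)%N -> (j <= m)%N ->
    wcos m.+1 (m.+1%:R - 2 * j%:R) = 0 /\ wsin m.+1 (m.+1%:R - 2 * j%:R) = 0.
  move=> j0 jm; rewrite wcosS wsinS.
  have -> : m.+1%:R - 2 * j%:R + 1 = m%:R - 2 * j.-1%:R :> R.
    by rewrite -{1}(prednK j0) -!natr1; ring.
  have -> : 1 - (m.+1%:R - 2 * j%:R) = m%:R - 2 * (m - j)%:R :> R.
    by rewrite natrB// -natr1; ring.
  rewrite !IH ?subrr ?addr0 ?mul0r ?mulr0 ?mul0r//.
    by rewrite ltn_subrL j0 (leq_trans j0 jm).
  by rewrite prednK.
case: l lm => [_|l lm]; last first.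
  by have [e1 e2] := low l.+1 isT lm; rewrite /wneg e1 e2 mul0r subrr.
have N0 := gegen_denom_neq0 k_gt0 m.+1.
suff E : wsin m.+1 m.+1%:R = (m.+1%:R + 2 * k) * wcos m.+1 m.+1%:R.
  by rewrite /wneg mulr0 subr0 E mulrAC divff// mul1r subrr.
have := wsin_ibp m.+1 m%:R; rewrite natr1.
(* The identity at t = m links the extreme frequency m + 1 to m - 1. In degree 1 these are 1 and -1,
   which parity identifies; in higher degrees m - 1 is interior and drops out. *)
case: m {IH N0} low => [|m] low.
  rewrite sub0r wcosN wsinN; lra.
have [e1 e2] := low 1%N isT isT.
have -> : m.+1%:R - 1 = m.+2%:R - 2 * 1%:R :> R by rewrite -!natr1; ring.
rewrite e1 e2 mulr0 !subr0 => ->; rewrite -(natr1 m.+1); ring.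
Qed.

(** Here both t and -t are covered by [wneg_eq0]; since [wcos] is even and [wsin] odd in t, each
    vanishes separately. *)
Lemma wcos_wsin_eq0 m l : (0 < l < m)%N ->
  wcos m (m%:R - 2 * l%:R) = 0 /\ wsin m (m%:R - 2 * l%:R) = 0.
Proof.
move=> /andP[l0 lm]; have N0 := gegen_denom_neq0 k_gt0 m.
have h1 := wneg_eq0 lm.
have : (m - l < m)%N by rewrite ltn_subrL l0 (leq_trans l0 (ltnW lm)).
move/wneg_eq0; rewrite natrB 1?ltnW//.
have -> : m%:R - 2 * (m%:R - l%:R) = - (m%:R - 2 * l%:R) :> R by ring.
move: h1; rewrite /wneg wcosN wsinN; move: (wcos _ _) (wsin _ _) => a b e1 e2.
have e3 : b / (m%:R + 2 * k) = 0 by move: e1 e2; rewrite mulNr; lra.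
have a0 : a = 0 by move: e1; rewrite e3 subr0.
by split => //; move/eqP: e3; rewrite mulf_eq0 invr_eq0 (negbTE N0) orbF => /eqP.
Qed.

Lemma nsE_ortho (nu lam : R) m (t : R) : wcos m t + wsin m t / nu = 0 ->
  cint `[(- pi)%R, pi]
    (fun z => lam%:C * nsE k nu m z * cexpi (- (t * z)) * (wk k z)%:C) = 0.
Proof.
move=> E.
pose h1 (z : R) := lam * (fa m t z + fb m t z / nu).
pose h2 (z : R) := lam * (sin z * (gegen k m)^`().[cos z] / nu * cos (t * z) -
  (gegen k m).[cos z] * sin (t * z)).
have -> : (fun z => lam%:C * nsE k nu m z * cexpi (- (t * z)) * (wk k z)%:C) =
    (fun z => Complex (h1 z * wk k z) (h2 z * wk k z)).
  apply/funext => z; rewrite /nsE /cexpi cosN sinN /h1 /h2 /fa /fb.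
  by apply/eqP; rewrite eq_complex/=; apply/andP; split; apply/eqP; ring.
have ch1 : continuous h1.
  move=> z; apply: cvgM; first exact: cvg_cst.
  by apply: cvgD; [exact: cfa|apply: cvgM; [exact: cfb|exact: cvg_cst]].
have ch2 : continuous h2.
  move=> z; apply: cvgM; first exact: cvg_cst.
  apply: cvgB; last by apply: cvgM; [exact: cts|exact: csin].
  apply: cvgM; last exact: ccos.
  by apply: cvgM; [apply: cvgM; [exact: continuous_sin|exact: cts]|exact: cvg_cst].
have ci (h : R -> R) : continuous h ->
    mu.-integrable `[(- pi)%R, pi] (EFin \o (fun z => h z * wk k z)).
  move=> ch; apply: integrable_continuous_itv => z.
  by apply: cvgM; [exact: ch|exact: continuous_wk].
have wkN z : wk k (- z) = wk k z by rewrite /wk sinN normrN.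
rewrite /cint/= (Rintegral_sym (pi_gt0 R) (ci _ ch1)) (Rintegral_sym (pi_gt0 R) (ci _ ch2)).
have -> : \int[mu]_(z in `]0%R, pi[) (h1 z * wk k z + h1 (- z) * wk k (- z)) =
    (2 * lam) * wcos m t + (2 * lam / nu) * wsin m t + 0 * wcos m t + 0 * wcos m t.
  rewrite -wint4//; apply: eq_Rintegral => z _.
  rewrite wkN /h1 /fa /fb mulrN cosN !sinN cosN; ring.
have -> : \int[mu]_(z in `]0%R, pi[) (h2 z * wk k z + h2 (- z) * wk k (- z)) = 0.
  rewrite -[RHS](mul0r (fine (mu `]0%R, pi[))) -Rintegral_cst//.
  apply: eq_Rintegral => z _.
  rewrite wkN /h2 mulrN cosN !sinN cosN; ring.
have -> : 2 * lam * wcos m t + 2 * lam / nu * wsin m t + 0 * wcos m t + 0 * wcos m t =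
   2 * lam * (wcos m t + wsin m t / nu) by ring.
by rewrite E mulr0.
Qed.

End Orthogonality.

(** * Exponential expansion and uniqueness *)

Section Expansion.
Variables (R : realType) (k : R).
Hypothesis k_gt0 : 0 < k.

Lemma cexpiD (s t : R) : cexpi (s + t) = cexpi s * cexpi t.
Proof. by rewrite /cexpi mulComplex cosD sinD; congr Complex; rewrite addrC mulrC (mulrC (sin t)). Qed.

(** The affine intertwiner relation of nonsymmetric polynomials: reflection followed by a shift of
    the frequency leads from -m to m + 1. *)
Lemma nsE_posS m (x : R) :
  nsE k m.+1%:R m.+1 x = cexpi x * nsE k (- (m%:R + 2 * k)) m (- x).
Proof.
have N0 := gegen_denom_neq0 k_gt0 m.
have M0 : m.+1%:R != 0 :> R by rewrite pnatr_eq0.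
rewrite /nsE /cexpi mulComplex cosN sinN gegenS_eval deriv_gegenS_eval// -sin2cos2.
by congr Complex; move: m.+1%:R M0 => n M0; field; rewrite ?N0 ?M0 ?oppr_eq0 ?N0.
Qed.

(** The coefficients are forced: their sum is 1 by the even part, and their difference matches the
    ratio of the two values of nu in the odd part. *)
Lemma nsE_negS m (x : R) :
  nsE k (- (m.+1%:R + 2 * k)) m.+1 x =
  ((m.+1%:R + k) / (m.+1%:R + 2 * k))%:C * nsE k m.+1%:R m.+1 (- x) +
  (k / (m.+1%:R + 2 * k))%:C * nsE k m.+1%:R m.+1 x.
Proof.
have N0 := gegen_denom_neq0 k_gt0 m.+1.
have M0 : m.+1%:R != 0 :> R by rewrite pnatr_eq0.
rewrite /nsE !mulrComplex cosN sinN.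
move: m.+1%:R M0 N0 => n M0 N0.
by apply/eqP; rewrite eq_complex/=; apply/andP; split; apply/eqP; field;
  rewrite ?N0 ?M0 ?oppr_eq0 ?N0.
Qed.

Definition expsum (m : nat) (g : nat -> R) (x : R) : R[i] :=
  \sum_(a < m.+1) (g a)%:C * cexpi ((2 * a%:R - m%:R) * x).

Lemma expsumN m g x : expsum m g (- x) = expsum m (fun a => g (m - a)%N) x.
Proof.
rewrite /expsum (reindex_inj rev_ord_inj)/=; apply: eq_bigr => a _.
rewrite subSS; congr (_ * cexpi _); rewrite natrB ?leq_ord//; ring.
Qed.

Lemma expsum_shift m g x :
  cexpi x * expsum m g x = expsum m.+1 (fun a => if a is a'.+1 then g a' else 0) x.
Proof.
rewrite /expsum [RHS]big_ord_recl/= mul0r add0r mulr_sumr; apply: eq_bigr => a _.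
rewrite mulrCA -cexpiD; congr (_ * cexpi _).
by rewrite ?lift0 ?/bump ?leq0n ?add1n -!natr1; ring.
Qed.

(** For n = m + 1 the frequency - (m + 1) is not below n, and [e 0 = 0] says that it is absent;
    [e m.+1] and [g 0] are the leading coefficients, by which one must divide. *)
Lemma nsE_expansion m : exists g e : nat -> R,
  [/\ g 0%N != 0, forall x, nsE k (- (m%:R + 2 * k)) m x = expsum m g x,
      e 0%N = 0, e m.+1 = g 0%N &
      forall x, nsE k m.+1%:R m.+1 x = expsum m.+1 e x].
Proof.
have pos n g : (forall x, nsE k (- (n%:R + 2 * k)) n x = expsum n g x) ->
    forall x, nsE k n.+1%:R n.+1 x =
      expsum n.+1 (fun a => if a is a'.+1 then g (n - a')%N else 0) x.
  by move=> gE x; rewrite nsE_posS gE expsumN expsum_shift.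
suff [g [g0 gE]] : exists g : nat -> R, g 0%N != 0 /\
    forall x, nsE k (- (m%:R + 2 * k)) m x = expsum m g x.
  exists g, (fun a => if a is a'.+1 then g (m - a')%N else 0).
  by split => //; [rewrite subnn|exact: pos].
elim: m => [|m [g [g0 gE]]].
  exists (fun=> 1); split; first exact: oner_neq0.
  move=> x; rewrite /expsum big_ord1 /nsE [gegen k 0]/= derivC horner0 -polyC1 hornerC.
  rewrite mulr0 mul0r /= mulr0 subrr mul0r.
  by rewrite /cexpi cos0 sin0 mulrComplex mulr1 mulr0.
have eE := pos _ _ gE; set e := (fun a : nat => _) in eE.
pose M : R := m.+1%:R.
exists (fun a => (M + k) / (M + 2 * k) * e (m.+1 - a)%N + k / (M + 2 * k) * e a).
split.
  rewrite /e/= subnn mulr0 addr0 !mulf_neq0//.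
    by rewrite gt_eqF// addr_gt0// ltr0n.
  by rewrite invr_neq0// gegen_denom_neq0.
move=> x; rewrite nsE_negS !eE expsumN /expsum !mulr_sumr -big_split/=.
by apply: eq_bigr => a _; rewrite !mulrA -!rmorphM -mulrDl -rmorphD.
Qed.

End Expansion.

(** * Matching exponential sums with the triangular form of E_n *)

Section FormExpansion.
Variable R : realType.

Lemma sum_even (V : nmodType) (G : nat -> V) M :
  \sum_(i < (2 * M).+1) (if odd i then 0 else G i./2) = \sum_(a < M.+1) G a.
Proof.
rewrite mul2n; elim: M => [|M IH]; first by rewrite !big_ord1.
rewrite doubleS big_ord_recr big_ord_recr [RHS]big_ord_recr -IH /= odd_double/= addr0.
by rewrite doubleK.
Qed.

Lemma tri_odd (i : nat) (n : int) : odd i -> tri (i%:Z - (`|n|)%:Z) n = false.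
Proof. by rewrite /tri => oi; apply/negP; lia. Qed.

(** [a0] indexes the leading frequency n, and dividing by [g a0] makes its coefficient 1. The last
    hypothesis excludes frequencies that are neither n nor below n. *)
Lemma Eform_expansion (n : int) (g : nat -> R) (a0 : nat) :
  (a0 <= `|n|)%N -> n = (2 * a0)%:Z - (`|n|)%:Z -> g a0 != 0 ->
  (forall a, (a <= `|n|)%N -> a != a0 -> ~~ tri ((2 * a)%:Z - (`|n|)%:Z) n -> g a = 0) ->
  exists c, forall x, Eform n c x = ((g a0)^-1)%:C * expsum `|n| g x.
Proof.
move=> a0n nE g0 gz.
(* The coefficient at j is read off at the index a with j = 2a - |n|. *)
exists (fun j => (g a0)^-1%:C * (g (`|j + (`|n|)%:Z|./2))%:C) => x.
have freq (a : nat) : ((2 * a)%:Z - (`|n|)%:Z)%:~R = 2 * a%:R - (`|n|)%:R :> R.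
  by rewrite intrB -!pmulrn natrM.
pose G a := if tri ((2 * a)%:Z - (`|n|)%:Z) n then
  (g a0)^-1%:C * (g a)%:C * cexpi ((2 * a%:R - (`|n|)%:R) * x) else 0.
rewrite /Eform (eq_bigr (fun i : 'I_(2 * `|n|).+1 => if odd i then 0 else G i./2)); last first.
  move=> i0 _; move: (nat_of_ord i0) => i; cbv zeta.
  have [oi|ei] := boolP (odd i); first by rewrite (tri_odd n oi).
  have [a ->] : exists a, i = (2 * a)%N.
    by exists i./2; rewrite mul2n -[LHS]odd_double_half (negbTE ei).
  have -> : (2 * a)./2 = a by rewrite mul2n doubleK.
  rewrite /G freq; case: ifP => // _.
  by rewrite subrK absz_nat mul2n doubleK.
rewrite sum_even /expsum mulr_sumr.
have a0o : (a0 < `|n|.+1)%N by rewrite ltnS.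
rewrite (bigD1 (Ordinal a0o))// [RHS](bigD1 (Ordinal a0o))//=.
have -> : G a0 = 0.
  by rewrite /G -nE /tri ltnn ltxx andbF.
rewrite add0r mulrA -rmorphM mulVf// rmorph1 mul1r; congr (cexpi (_ * x) + _).
  by rewrite {1}nE freq.
apply: eq_bigr => a aa0; rewrite /G mulrA; case: ifPn => // /gz h.
by rewrite h ?mulr0 ?mul0r ?rmorph0 ?mulr0 ?mul0r// -ltnS ltn_ord.
Qed.

End FormExpansion.

(** * Weighted complex integrals and uniqueness of E_n *)

Section Uniqueness.
Variables (R : realType) (k : R).
Hypothesis k_gt0 : 0 < k.
Local Notation mu := (@lebesgue_measure R).
Local Notation Re := complex.Re.
Local Notation Im := complex.Im.

Definition ccont (f : R -> R[i]) :=
  continuous (fun z => Re (f z)) /\ continuous (fun z => Im (f z)).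

Let ReD (u v : R[i]) : Re (u + v) = Re u + Re v. Proof. by case: u; case: v. Qed.
Let ImD (u v : R[i]) : Im (u + v) = Im u + Im v. Proof. by case: u; case: v. Qed.
Let ReM (u v : R[i]) : Re (u * v) = Re u * Re v - Im u * Im v.
Proof. by case: u; case: v. Qed.
Let ImM (u v : R[i]) : Im (u * v) = Re u * Im v + Im u * Re v.
Proof. by case: u; case: v. Qed.

Lemma eq_ccont (f g : R -> R[i]) : f =1 g -> ccont g -> ccont f.
Proof. by move=> /funext ->. Qed.

Lemma ccontD f g : ccont f -> ccont g -> ccont (fun z => f z + g z).
Proof.
move=> [f1 f2] [g1 g2]; split => z.
- rewrite (_ : (fun z => _) = (fun z => Re (f z) + Re (g z))).
    by apply: cvgD; [exact: f1|exact: g1].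
  by apply/funext => t; rewrite ReD.
- rewrite (_ : (fun z => _) = (fun z => Im (f z) + Im (g z))).
    by apply: cvgD; [exact: f2|exact: g2].
  by apply/funext => t; rewrite ImD.
Qed.

Lemma ccontM f g : ccont f -> ccont g -> ccont (fun z => f z * g z).
Proof.
move=> [f1 f2] [g1 g2]; split => z.
- rewrite (_ : (fun z => _) = (fun z => Re (f z) * Re (g z) - Im (f z) * Im (g z))).
    by apply: cvgB; apply: cvgM; [exact: f1|exact: g1|exact: f2|exact: g2].
  by apply/funext => t; rewrite ReM.
- rewrite (_ : (fun z => _) = (fun z => Re (f z) * Im (g z) + Im (f z) * Re (g z))).
    by apply: cvgD; apply: cvgM; [exact: f1|exact: g2|exact: f2|exact: g1].
  by apply/funext => t; rewrite ImM.
Qed.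

Lemma ccont_cst (c : R[i]) : ccont (fun=> c).
Proof. by split => z; exact: cvg_cst. Qed.

Lemma ccont_cexpi (t : R) : ccont (fun z => cexpi (t * z)).
Proof.
have ct : continuous (fun z : R => t * z).
  by move=> z; apply: cvgM; [exact: cvg_cst|exact: cvg_id].
by split => z; apply: continuous_comp; [exact: ct|exact: continuous_cos|exact: ct|
  exact: continuous_sin].
Qed.

Lemma ccont_sum (I : Type) (s : seq I) (f : I -> R -> R[i]) :
  (forall i, ccont (f i)) -> ccont (fun z => \sum_(i <- s) f i z).
Proof.
move=> cf; elim: s => [|i s IH].
  by apply: (eq_ccont (g := fun=> 0)); [move=> z; rewrite big_nil|exact: ccont_cst].
apply: (eq_ccont (g := fun z => f i z + \sum_(j <- s) f j z)); last exact: ccontD.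
by move=> z; rewrite big_cons.
Qed.

Lemma ccont_Eform n c : ccont (Eform n c).
Proof.
apply: ccontD; first exact: ccont_cexpi.
apply: ccont_sum => i; cbv zeta; case: (tri _ n); last exact: ccont_cst.
by apply: ccontM; [exact: ccont_cst|exact: ccont_cexpi].
Qed.

Definition wcint (f : R -> R[i]) : R[i] :=
  cint `[(- pi)%R, pi] (fun z => f z * (wk k z)%:C).

Let wcintE f : wcint f = Complex (\int[mu]_(z in `[(- pi)%R, pi]) (Re (f z) * wk k z))
  (\int[mu]_(z in `[(- pi)%R, pi]) (Im (f z) * wk k z)).
Proof.
rewrite /wcint /cint; congr Complex; apply: eq_Rintegral => z _.
- by rewrite ReM/= mulr0 subr0.
- by rewrite ImM/= mulr0 add0r.
Qed.

Let ci (h : R -> R) : continuous h ->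
  mu.-integrable `[(- pi)%R, pi] (EFin \o (fun z => h z * wk k z)).
Proof.
move=> ch; apply: integrable_continuous_itv => z.
by apply: cvgM; [exact: ch|exact: continuous_wk].
Qed.

Lemma wcint_lin (c : R[i]) f g : ccont f -> ccont g ->
  wcint (fun z => c * f z + g z) = c * wcint f + wcint g.
Proof.
case: c => c1 c2 [f1 f2] [g1 g2]; rewrite !wcintE.
have lin (r s : R) (h1 h2 h3 : R -> R) : continuous h1 -> continuous h2 -> continuous h3 ->
    \int[mu]_(z in `[(- pi)%R, pi]) ((r * h1 z + s * h2 z + h3 z) * wk k z) =
    r * \int[mu]_(z in `[(- pi)%R, pi]) (h1 z * wk k z) +
    s * \int[mu]_(z in `[(- pi)%R, pi]) (h2 z * wk k z) +
    \int[mu]_(z in `[(- pi)%R, pi]) (h3 z * wk k z).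
  move=> k1 k2 k3; rewrite -!RintegralZl//; [|exact: ci|exact: ci].
  have i1 : mu.-integrable `[(- pi)%R, pi] (EFin \o (fun z => r * (h1 z * wk k z))).
    by apply: integrable_scale => //; exact: ci.
  have i2 : mu.-integrable `[(- pi)%R, pi] (EFin \o (fun z => s * (h2 z * wk k z))).
    by apply: integrable_scale => //; exact: ci.
  rewrite -RintegralD// -RintegralD//; last exact: ci.
    by apply: eq_Rintegral => z _; ring.
  have := integrableD (measurable_itv `[(- pi)%R, pi] : measurable (_ : set (measurableTypeR R))) i1 i2.
  by apply: eq_integrable.
apply/eqP; rewrite eq_complex/=; apply/andP; split; apply/eqP.
- transitivity (\int[mu]_(z in `[(- pi)%R, pi])
     ((c1 * Re (f z) + (- c2) * Im (f z) + Re (g z)) * wk k z)).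
    by apply: eq_Rintegral => z _; rewrite ReD ReM/=; ring.
  by rewrite lin//; ring.
- transitivity (\int[mu]_(z in `[(- pi)%R, pi])
     ((c1 * Im (f z) + c2 * Re (f z) + Im (g z)) * wk k z)).
    by apply: eq_Rintegral => z _; rewrite ImD ImM/=; ring.
  by rewrite lin//; ring.
Qed.

Lemma eq_wcint (f g : R -> R[i]) : f =1 g -> wcint f = wcint g.
Proof. by move=> /funext ->. Qed.

Lemma wcint0 : wcint (fun=> 0) = 0.
Proof.
have := wcint_lin (-1) (ccont_cst 0) (ccont_cst 0).
rewrite (eq_wcint (g := fun=> 0)); first by rewrite mulN1r addNr.
by move=> z; rewrite mulr0 addr0.
Qed.

Lemma wcint_sum_eq0 (I : Type) (s : seq I) (f : I -> R -> R[i]) :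
  (forall i, ccont (f i)) -> (forall i, wcint (f i) = 0) ->
  wcint (fun z => \sum_(i <- s) f i z) = 0.
Proof.
move=> cf f0; elim: s => [|i s IH].
  by rewrite (eq_wcint (g := fun=> 0)) ?wcint0// => z; rewrite big_nil.
rewrite (eq_wcint (g := fun z => 1 * f i z + \sum_(j <- s) f j z)).
  by rewrite wcint_lin ?f0 ?IH ?mulr0 ?addr0//; exact: ccont_sum.
by move=> z; rewrite big_cons mul1r.
Qed.

Lemma continuous_eq0_itvcc (f : R -> R) (a b : R) : a < b -> continuous f ->
  {in `]a, b[, forall z, f z = 0} -> {in `[a, b], forall z, f z = 0}.
Proof.
move=> ab cf f0 z; rewrite in_itv/= => /andP[].
rewrite le_eqVlt => /orP[/eqP<- _|az].
  have h1 : f x @[x --> a^'+] --> f a by apply: cvg_at_right_filter; exact: cf.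
  have h2 : f x @[x --> a^'+] --> (0 : R).
    by apply: cvg_near_cst; near=> x; apply: f0; rewrite in_itv/=; apply/andP; split.
  exact: (cvg_unique _ h1 h2).
rewrite le_eqVlt => /orP[/eqP->|zb]; last by apply: f0; rewrite in_itv/= az.
have h1 : f x @[x --> b^'-] --> f b by apply: cvg_at_left_filter; exact: cf.
have h2 : f x @[x --> b^'-] --> (0 : R).
  by apply: cvg_near_cst; near=> x; apply: f0; rewrite in_itv/=; apply/andP; split.
exact: (cvg_unique _ h1 h2).
Unshelve. all: by end_near. Qed.

Lemma continuous_integral_eq0 (q : R -> R) (a b : R) : continuous q ->
  (forall z, 0 <= q z) -> \int[mu]_(z in `[a, b]) q z = 0 ->
  {in `]a, b[, forall z, q z = 0}.
Proof.
move=> cq q0 I0 z zab; apply/eqP; rewrite eq_le q0 andbT leNgt; apply/negP => qz.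
have : \forall t \near z, 0 < q t by exact: (cvgr_gt _ (cq z)).
have : \forall t \near z, t \in `]a, b[ by exact: near_in_itvoo.
move=> n1 n2; have [e /= e0 sub] := filterI n1 n2.
have subE (t : R) : t \in `](z - e)%R, (z + e)%R[ -> (t \in `]a, b[) /\ (0 < q t).
  by rewrite in_itv/= => h; apply: sub; rewrite /= ltr_distlC.
have pos : (0 < \int[mu]_(t in `](z - e)%R, (z + e)%R[) (q t)%:E)%E.
  apply: integral_pos_gt0 => //.
  - rewrite lebesgue_measure_itv/= lte_fin ifT; last by lra.
    by rewrite -EFinD lte_fin; lra.
  - by apply: measurable_funTS; exact: continuous_measurable_fun.
  - by move=> t /= /subE[].
have iq := integrable_continuous_itv a b cq.
have : (\int[mu]_(t in `](z - e)%R, (z + e)%R[) (q t)%:E <= \int[mu]_(t in `[a, b]) (q t)%:E)%E.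
  apply: ge0_subset_integral => //.
  - by apply/measurable_EFinP; apply: measurable_funTS; exact: continuous_measurable_fun.
  - by move=> t _; rewrite lee_fin.
  - by move=> t /= /subE[h _]; exact: subset_itv_oo_cc.
have fin : (\int[mu]_(t in `[a, b]) (q t)%:E)%E \is a fin_num by exact: integrable_fin_num.
rewrite leNgt -(fineK fin) -[fine _]/(\int[mu]_(t in `[a, b]) q t) I0.
by rewrite pos.
Qed.

(** The difference of two solutions is a combination of the very exponentials to which it is
    orthogonal, so its weighted square norm is 0. Functions are compared rather than coefficients,
    since [Ortho] says nothing about coefficients outside the order ideal of n. *)
Lemma Ortho_unique n c1 c2 : Ortho k n c1 -> Ortho k n c2 ->
  {in `[- pi, pi], forall z, Eform n c1 z = Eform n c2 z}.
Proof.
move=> O1 O2.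
pose D z := -1 * Eform n c2 z + Eform n c1 z.
have cD : ccont D.
  apply: ccontD; last exact: ccont_Eform.
  by apply: ccontM; [exact: ccont_cst|exact: ccont_Eform].
have cexpiN (t z : R) : cexpi (- (t * z)) = cexpi ((- t) * z) by rewrite mulNr.
have cce (t : R) : ccont (fun z => cexpi (- (t * z))).
  apply: (eq_ccont (g := fun z => cexpi ((- t) * z))); last exact: ccont_cexpi.
  by move=> z; rewrite cexpiN.
have D0 (j : int) : tri j n -> wcint (fun z => D z * cexpi (- (j%:~R * z))) = 0.
  move=> tj; have cc c : ccont (fun z => Eform n c z * cexpi (- (j%:~R * z))).
    apply: ccontM; first exact: ccont_Eform.
    exact: cce.
  have := wcint_lin (-1) (cc c2) (cc c1).
  rewrite [wcint (fun z => Eform n c1 z * _)]O1// [wcint (fun z => Eform n c2 z * _)]O2//.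
  rewrite mulr0 addr0 => <-; congr wcint; apply/funext => z; rewrite /D; ring.
pose d (j : int) := c1 j - c2 j.
have DE z : D z = \sum_(i < (2 * `|n|).+1) (let j := (i%:Z - (`|n|)%:Z)%R in
    if tri j n then d j * cexpi (j%:~R * z) else 0).
  rewrite /D /Eform mulN1r opprD addrACA addNr add0r -sumrN -big_split/=.
  apply: eq_bigr => i _; case: ifP => _; last by rewrite oppr0 addr0.
  by rewrite /d; ring.
pose conj (u : R[i]) := Complex (Re u) (- Im u).
have conjD u v : conj (u + v) = conj u + conj v.
  by case: u => a b; case: v => a' b'; rewrite /conj/=; congr Complex; rewrite ?opprD.
have conjE z : conj (D z) = \sum_(i < (2 * `|n|).+1) (let j := (i%:Z - (`|n|)%:Z)%R in
    if tri j n then conj (d j) * cexpi (- (j%:~R * z)) else 0).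
  rewrite DE.
  have conjS (s : seq 'I_(2 * `|n|).+1) (F : 'I_(2 * `|n|).+1 -> R[i]) :
      conj (\sum_(i <- s) F i) = \sum_(i <- s) conj (F i).
    elim: s => [|i s IH]; last by rewrite !big_cons conjD IH.
    by rewrite !big_nil /conj/= oppr0.
  rewrite conjS; apply: eq_bigr => i _ /=; case: ifP => _; last by rewrite /conj/= oppr0.
  case: (d _) => a b; rewrite /conj /cexpi cosN sinN.
  by apply/eqP; rewrite eq_complex/=; apply/andP; split; apply/eqP; ring.
have W0 : wcint (fun z => D z * conj (D z)) = 0.
  rewrite (eq_wcint (g := fun z => \sum_(i < (2 * `|n|).+1)
    D z * (let j := (i%:Z - (`|n|)%:Z)%R in
    if tri j n then conj (d j) * cexpi (- (j%:~R * z)) else 0))); last first.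
    by move=> z; rewrite conjE mulr_sumr.
  apply: wcint_sum_eq0 => i; cbv zeta; case ti: (tri (i%:Z - (`|n|)%:Z) n).
  - by apply: ccontM => //; apply: ccontM; [exact: ccont_cst|exact: cce].
  - by apply: ccontM => //; exact: ccont_cst.
  - rewrite (eq_wcint (g := fun z => conj (d (i%:Z - (`|n|)%:Z)) *
      (D z * cexpi (- ((i%:Z - (`|n|)%:Z)%:~R * z))) + 0)); last first.
      by move=> z; rewrite mulrCA addr0.
    rewrite wcint_lin ?D0 ?wcint0 ?mulr0 ?addr0//; last exact: ccont_cst.
    by apply: ccontM => //; exact: cce.
  - by rewrite (eq_wcint (g := fun=> 0)) ?wcint0// => z; rewrite mulr0.
pose E (z : R) := Re (D z) ^+ 2 + Im (D z) ^+ 2.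
have cE : continuous E.
  rewrite (_ : E = fun z => Re (D z) * Re (D z) + Im (D z) * Im (D z)); last first.
    by apply/funext => z; rewrite /E !expr2.
  by move=> z; apply: cvgD; apply: cvgM; by [exact: cD.1|exact: cD.2].
have E_ge0 z : 0 <= E z by rewrite addr_ge0 ?sqr_ge0.
have IE : \int[mu]_(z in `[(- pi)%R, pi]) (E z * wk k z) = 0.
  move: W0; rewrite wcintE => -[+ _] => <-.
  by apply: eq_Rintegral => z _; rewrite ReM /E/=; ring.
have EW : {in `](- pi)%R, pi[, forall z, E z * wk k z = 0}.
  apply: continuous_integral_eq0 IE.
  - by move=> z; apply: cvgM; [exact: cE|exact: continuous_wk].
  - by move=> z; rewrite mulr_ge0// powR_ge0.
have pi0 := pi_gt0 R.
(* The weight vanishes at 0, pi and -pi, so E is first seen to be 0 on the two open halves and then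
   at these points by continuity. *)
have Epos : {in `]0, pi[, forall z, E z = 0}.
  move=> z zi; have := EW z; rewrite in_itv/=; move: zi; rewrite in_itv/= => /andP[z0 zp].
  rewrite zp (lt_trans _ z0) ?oppr_lt0// => /(_ isT)/eqP; rewrite mulf_eq0.
  by rewrite [wk k z == 0]gt_eqF ?orbF => [/eqP//|]; rewrite powR_gt0// normr_gt0 gt_eqF// sin_gt0_pi// z0.
have Eneg : {in `]- pi, 0[, forall z, E z = 0}.
  move=> z zi; have := EW z; rewrite in_itv/=; move: zi; rewrite in_itv/= => /andP[z0 zp].
  rewrite z0 (lt_trans zp)// => /(_ isT)/eqP; rewrite mulf_eq0.
  rewrite [wk k z == 0]gt_eqF ?orbF => [/eqP//|]; rewrite powR_gt0// normr_gt0 -oppr_eq0 -sinN.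
  by rewrite gt_eqF// sin_gt0_pi// oppr_gt0 zp ltrNl.
have Eall : {in `[- pi, pi], forall z, E z = 0}.
  move=> z; rewrite in_itv/= => /andP[h1 h2]; have [z0|z0] := leP 0 z.
    by apply: (continuous_eq0_itvcc pi0 cE Epos); rewrite in_itv/= z0.
  have Np : - pi < 0 :> R by rewrite oppr_lt0.
  by apply: (continuous_eq0_itvcc Np cE Eneg); rewrite in_itv/= h1 ltW.
move=> z /Eall /eqP; rewrite paddr_eq0 ?sqr_ge0// !sqrf_eq0 => /andP[r0 i0].
have : D z = 0 by apply/eqP; rewrite eq_complex r0 i0.
by rewrite /D mulN1r addrC => /eqP; rewrite subr_eq0 => /eqP.
Qed.

End Uniqueness.

(** * Conclusion *)

Section Identification.
Variables (R : realType) (k : R).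
Hypothesis k_gt0 : 0 < k.

(** The explicit family shows that [Ortho] is satisfiable, so [epsilon] returns a solution, and
    uniqueness identifies the two functions. [L] is the inverse of the leading coefficient and
    cancels in [calE]. *)
Lemma Ek_nsE (n : int) : exists nu L : R,
  [/\ nu != 0, nu * (nu + 2 * k) = (`|n|)%:R * ((`|n|)%:R + 2 * k), L != 0 &
    {in `[- pi, pi], forall x, Ek k n x = L%:C * nsE k nu `|n| x}].
Proof.
suff [nu [L [c [nu0 nuE L0 cE cO]]]] : exists nu L c,
    [/\ nu != 0, nu * (nu + 2 * k) = (`|n|)%:R * ((`|n|)%:R + 2 * k), L != 0,
      forall x, Eform n c x = L%:C * nsE k nu `|n| x & Ortho k n c].
  exists nu, L; split => // x xi; rewrite -cE.
  apply: (Ortho_unique k_gt0 _ cO) => //.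
  by rewrite /Ecoef; apply: ClassicalEpsilon.epsilon_spec; exists c.
have freq (m l : nat) (j : int) : j = m%:Z - (2 * l)%:Z ->
    j%:~R = m%:R - 2 * l%:R :> R.
  by move=> ->; rewrite intrB -!pmulrn natrM.
have [n0|n0] := leP n 0.
  have [g [_ [g0 gE _ _ _]]] := nsE_expansion k_gt0 `|n|.
  have N0 := gegen_denom_neq0 k_gt0 `|n|.
  have [||||c cE] := @Eform_expansion R n g 0 => //.
  - by lia.
  - move=> a an a0; rewrite /tri => h; exfalso; move: h; apply/negP; rewrite negbK.
    by lia.
  exists (- ((`|n|)%:R + 2 * k)), (g 0%N)^-1, c; split.
  - by rewrite oppr_eq0.
  - by ring.
  - by rewrite invr_neq0.
  - by move=> x; rewrite cE -gE.
  - move=> j tj; rewrite (_ : (fun z => _) = (fun z => (g 0%N)^-1%:C *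
      nsE k (- ((`|n|)%:R + 2 * k)) `|n| z * cexpi (- (j%:~R * z)) * (wk k z)%:C)).
      apply: nsE_ortho => //.
      (* The index is l = (|n| - j) / 2; for n <= 0 the value l = 0, that is j = |n|, does occur,
         whereas for n > 0 it does not. *)
      have [l lm jE] : exists2 l, (l < `|n|)%N & j = (`|n|)%:Z - (2 * l)%:Z.
        by exists (`|(`|n|)%:Z - j|./2)%N; move: tj; rewrite /tri; lia.
      have := wneg_eq0 k_gt0 lm; rewrite /wneg -(freq _ _ _ jE) => <-.
      by rewrite invrN mulrN.
    by apply/funext => z; rewrite cE -gE.
have [m mE] : exists m, `|n|%N = m.+1 by exists `|n|.-1; lia.
have [g [e [g0 _ e0 eS eE]]] := nsE_expansion k_gt0 m.
rewrite -mE in eS eE.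
have en0 : e `|n|%N != 0 by rewrite eS.
have [||||c cE] := @Eform_expansion R n e `|n|%N => //.
- by lia.
- move=> a an aa; have [->//|a0] := eqVneq a 0%N.
  rewrite /tri => h; exfalso; move: h; apply/negP; rewrite negbK.
  by lia.
exists (`|n|)%:R, (e `|n|%N)^-1, c; split.
- by rewrite pnatr_eq0 mE.
- by [].
- by rewrite invr_neq0.
- by move=> x; rewrite cE -eE.
- move=> j tj; rewrite (_ : (fun z => _) = (fun z => (e `|n|%N)^-1%:C *
    nsE k (`|n|)%:R `|n| z * cexpi (- (j%:~R * z)) * (wk k z)%:C)).
    apply: nsE_ortho => //.
    have [l lm jE] : exists2 l, (0 < l < `|n|)%N & j = (`|n|)%:Z - (2 * l)%:Z.
      by exists (`|(`|n|)%:Z - j|./2)%N; move: tj; rewrite /tri; lia.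
    have [w1 w2] := wcos_wsin_eq0 k_gt0 lm.
    by rewrite (freq _ _ _ jE) w1 w2 mul0r addr0.
  by apply/funext => z; rewrite cE -eE.
Qed.

Lemma gegen_parity m (u : R) : (gegen k m).[- u] = (-1) ^+ m * (gegen k m).[u] /\
  (gegen k m)^`().[- u] = - (-1) ^+ m * (gegen k m)^`().[u].
Proof.
elim: m => [|m [IH1 IH2]].
  by rewrite [gegen k 0]/= derivC -polyC1 !horner0 !hornerC mulr0 mulr1.
by rewrite !gegenS_eval !deriv_gegenS_eval// IH1 IH2 sqrrN !(exprS (-1) m); split; ring.
Qed.

Lemma nsE0 nu m : nsE k nu m 0 = 1.
Proof. by rewrite /nsE cos0 sin0 gegen1 !mul0r. Qed.

(** By the parity of A_m a half turn multiplies by (-1)^m. At y = pi or -pi the factor for y is this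
    same sign, which gives the shifted Dirac masses. *)
Lemma nsE_pi_shift nu m (x p : R) : cos (x + p) = - cos x -> sin (x + p) = - sin x ->
  nsE k nu m (x + p) = ((-1) ^+ m)%:C * nsE k nu m x.
Proof.
move=> cE sE; have [h1 h2] := gegen_parity m (cos x).
by rewrite /nsE mulrComplex cE sE h1 h2; congr Complex; ring.
Qed.

Lemma nsE_shiftpi nu m (x : R) :
  nsE k nu m (shiftpi x) = ((-1) ^+ m)%:C * nsE k nu m x.
Proof.
rewrite /shiftpi; case: ifP => _; apply: nsE_pi_shift.
- exact: cosDpi.
- exact: sinDpi.
- by rewrite cosB cospi sinpi; ring.
- by rewrite sinB cospi sinpi; ring.
Qed.

Lemma nsE_pi nu m (x : R) : x = pi \/ x = - pi -> nsE k nu m x = ((-1) ^+ m)%:C.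
Proof.
move=> xE; have -> : x = 0 + x by rewrite add0r.
rewrite nsE_pi_shift ?nsE0 ?mulr1//.
- by case: xE => ->; rewrite add0r ?cosN cospi cos0.
- by case: xE => ->; rewrite add0r ?sinN sinpi sin0 oppr0.
Qed.

End Identification.

Theorem mainTheorem7 (R : realType) (k : R) (n : int) (hk : 0 < k)
  (x y : R) (hx : - pi <= x <= pi) (hy : - pi <= y <= pi) :
  (sin x * sin y != 0 ->
     cintegrable `[(- pi)%R, pi]
       (fun z => calE k n z * calW k x y z * (wk k z)%:C) /\
     calE k n x * calE k n y =
     cint `[(- pi)%R, pi] (fun z => calE k n z * calW k x y z * (wk k z)%:C)) /\
  (y = 0 -> calE k n x * calE k n y = calE k n x) /\
  (x = 0 -> calE k n x * calE k n y = calE k n y) /\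
  ((y = pi \/ y = - pi) -> calE k n x * calE k n y = calE k n (shiftpi x)) /\
  ((x = pi \/ x = - pi) -> calE k n x * calE k n y = calE k n (shiftpi y)).
Proof.
have [nu [L [nu0 nuE L0 EkE]]] := Ek_nsE hk n.
have pi0 := pi_gt0 R.
have i0 : (0 : R) \in `[- pi, pi] by rewrite in_itv/= oppr_le0 ltW.
(* The identification holds on [-pi, pi] only, where uniqueness was proved, so the shifted points
   must be checked to lie there. *)
have calEE z : - pi <= z <= pi -> calE k n z = nsE k nu `|n| z.
  move=> zi; have zi' : z \in `[- pi, pi] by rewrite in_itv.
  rewrite /calE (EkE z zi') (EkE 0 i0).
  have LC : L%:C != 0 :> R[i] by rewrite eq_complex/= negb_and L0.
  by rewrite nsE0// mulr1 mulrAC divff// mul1r.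
have shift_itv z : - pi <= z <= pi -> - pi <= shiftpi z <= pi.
  by rewrite /shiftpi => /andP[h1 h2]; case: ifPn => h; apply/andP; split; lra.
rewrite !calEE ?shift_itv//; split; last split; last split; last split.
- move=> sxy; have [[i1 i2] E] := nsE_product hk hx hy sxy nu0 nuE.
  have eqf z : z \in `[(- pi)%R, pi]%classic ->
      calE k n z * calW k x y z * (wk k z)%:C = nsE k nu `|n| z * calW k x y z * (wk k z)%:C.
    by move=> /set_mem/=; rewrite in_itv/= => zi; rewrite calEE.
  split; last first.
    by rewrite E /cint; congr Complex; apply: eq_Rintegral => z zi; rewrite eqf.
  by split; [move: i1|move: i2]; apply: eq_integrable => // z zi; rewrite eqf.
- by move=> ->; rewrite nsE0 mulr1.
- by move=> ->; rewrite nsE0 mul1r.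
- by move=> yE; rewrite (nsE_shiftpi hk) (nsE_pi hk _ _ yE) mulrC.
- by move=> xE; rewrite (nsE_shiftpi hk) (nsE_pi hk _ _ xE).
Qed.
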